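(* Assume there are $K>0$ and a real $\beta\le\frac12$ such that $a_{j,k}\le K(jk)^\beta$ for all $j,k\in\mathbb N$. Let $c=(c_j)$ be a solution of the RBK system on $[0,\infty)$, and let $(g_j)_{j\in\mathbb N}$ be a real sequence such that $0\le g_j\le j$ for all $j$ and, for some constant $M>0$, $|g_j-g_{j-k}|\le Mk$ whenever $1\le k<j$. Then for every $m\in\mathbb N$ the function $t\mapsto\sum_{j=m}^\infty g_jc_j(t)$ is continuously differentiable on $[0,\infty)$ and, for all $t\ge 0$, $$\frac{d}{dt}\sum_{j=m}^\infty g_jc_j(t)=-\sum_{(j,k)\in S_1(m,\infty)}(g_j-g_{j-k})W_{j,k}(c(t))-\sum_{(j,k)\in S_2(m,\infty)}g_jW_{j,k}(c(t)).$$ In particular, for all $t\ge0$ (with $W_{j,k}=W_{j,k}(c(t))$), $$\frac{d}{dt}\sum_{j=1}^\infty jc_j(t)=-2\sum_{j=1}^\infty\sum_{k=j+1}^\infty jW_{j,k}-\sum_{j=1}^\infty jW_{j,j},$$ $$\frac{d}{dt}\sum_{j=1}^\infty c_j(t)=-\frac12\sum_{j=1}^\infty\sum_{k=1}^\infty W_{j,k}-\frac12\sum_{j=1}^\infty W_{j,j},$$ $$\frac{d}{dt}\sum_{j\ \mathrm{odd}}c_j(t)=-\sum_{j\ \mathrm{odd}}\ \sum_{k\ \mathrm{odd}}W_{j,k}.$$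
   Context: The rate coefficients $a_{j,k}$ ($j,k\in\mathbb N=\{1,2,\dots\}$) are real with $a_{j,k}=a_{k,j}\ge 0$. The Redner--Ben-Avraham--Kahng (RBK) system is $$\frac{dc_j}{dt}=\sum_{k=1}^\infty a_{j+k,k}c_{j+k}c_k-\sum_{k=1}^\infty a_{j,k}c_jc_k,\qquad j\in\mathbb N,$$ and $W_{j,k}(c):=a_{j,k}c_jc_k$. $X_1=\{x=(x_j)\in\mathbb R^{\mathbb N}: \|x\|_1:=\sum_{j=1}^\infty j|x_j|<\infty\}$ and $X_1^+=\{x\in X_1: x_j\ge 0\ \forall j\}$. Definition (solution). Let $T\in(0,+\infty]$. A (mild) solution of the RBK system on $[0,T)$ with $c(0)=c_0\in X_1^+$ is a function $c=(c_j):[0,T)\to X_1^+$ such that: (i) each $c_j:[0,T)\to[0,\infty)$ is continuous and $\sup_{t\in[0,T)}\|c(t)\|_1<\infty$; (ii) for all $j\in\mathbb N$ and $t\in[0,T)$, $\int_0^t\sum_{k=1}^\infty a_{j,k}c_k(s)\,ds<\infty$; (iii) for all $j\in\mathbb N$ and $t\in[0,T)$, $$c_j(t)=c_{0j}+\int_0^t\Big[\sum_{k=1}^\infty a_{j+k,k}c_{j+k}(s)c_k(s)-\sum_{k=1}^\infty a_{j,k}c_j(s)c_k(s)\Big]ds.$$ Index sets: $S_1(m,\infty)=\{(j,k)\in\mathbb N^2: j\ge m+1,\ 1\le k\le j-m\}$ and $S_2(m,\infty)=\{(j,k)\in\mathbb N^2: j\ge m,\ k\ge j-m+1\}$. Derivatives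 at $t=0$ are one-sided. *)

(* Defs.v *)
From mathcomp Require Import all_boot all_order all_algebra.
From mathcomp Require Import all_classical all_reals all_analysis.
Import Order.TTheory GRing.Theory Num.Theory.
Import numFieldNormedType.Exports.

Set Implicit Arguments.
Unset Strict Implicit.
Unset Printing Implicit Defensive.

Local Open Scope classical_set_scope.
Local Open Scope ring_scope.

(* Sequences indexed by {1, 2, ...} are functions on nat whose value at 0 is
   irrelevant: every condition and every sum below ranges over indices >= 1. *)

Definition rate_coefficients (R : realType) (a : nat -> nat -> R) : Prop :=
  forall j k : nat, (1 <= j)%N -> (1 <= k)%N -> 0 <= a j k /\ a j k = a k j.

Definition norm1 (R : realType) (x : nat -> R) : \bar R :=
  (\sum_(1 <= j <oo) (j%:R * `|x j|)%:E)%E.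

Definition X1 (R : realType) : set (nat -> R) :=
  [set x | (norm1 x < +oo)%E].

Definition X1pos (R : realType) : set (nat -> R) :=
  [set x | X1 x /\ forall j : nat, (1 <= j)%N -> 0 <= x j].

(* The interval [0, T), where T may be +oo. *)
Definition time_domain (R : realType) (T : \bar R) : set R :=
  [set t | 0 <= t /\ (t%:E < T)%E].

Definition W (R : realType) (a : nat -> nat -> R) (x : nat -> R) (j k : nat) : R :=
  a j k * x j * x k.

(* [c t j] is c_j(t); only the values of [c] on [0, T) matter.
   In [rbk_mild] both series have nonnegative terms and are taken in \bar R.
   By [rbk_rate_integrable] the subtracted one is integrable on [0, t], so the
   difference is well defined almost everywhere; since the left-hand side is
   finite, the equation forces the integral to be finite too. *)
Record rbk_solution (R : realType) (a : nat -> nat -> R) (T : \bar R)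
    (c0 : nat -> R) (c : R -> nat -> R) : Prop := RbkSolution {
  rbk_horizon : (0 < T)%E ;
  rbk_initial : X1pos c0 ;
  rbk_values : forall t : R, time_domain T t -> X1pos (c t) ;
  rbk_continuous : forall j : nat, (1 <= j)%N ->
    {within time_domain T, continuous (fun t => c t j)} ;
  rbk_bounded :
    (ereal_sup [set norm1 (c t) | t in time_domain T] < +oo)%E ;
  rbk_rate_integrable : forall (j : nat) (t : R),
    (1 <= j)%N -> time_domain T t ->
    (\int[lebesgue_measure]_(s in `[0%R, t])
        (\sum_(1 <= k <oo) (a j k * c s k)%:E) < +oo)%E ;
  rbk_mild : forall (j : nat) (t : R),
    (1 <= j)%N -> time_domain T t ->
    ((c t j)%:E = (c0 j)%:E + \int[lebesgue_measure]_(s in `[0%R, t])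
        (\sum_(1 <= k <oo) (W a (c s) (j + k) k)%:E
         - \sum_(1 <= k <oo) (W a (c s) j k)%:E))%E }.

Definition S1 (m : nat) : set (nat * nat) :=
  [set p | (m.+1 <= p.1)%N /\ (1 <= p.2 <= p.1 - m)%N].

Definition S2 (m : nat) : set (nat * nat) :=
  [set p | (m <= p.1)%N /\ ((p.1 - m).+1 <= p.2)%N].

(* [\esum] is a supremum of finite partial sums, hence meaningful for
   nonnegative families only; a family of reals of arbitrary signs is summed
   by splitting it, which is legitimate when it is [summable]. *)
Definition signed_esum (R : realType) (I : choiceType) (D : set I)
    (f : I -> R) : \bar R :=
  (esum D (EFin \o f)^\+ - esum D (EFin \o f)^\-)%E.

(* F has derivative d at t relative to A; at an endpoint of an interval A this
   is the one-sided derivative. *)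
Definition has_derivative_within (R : realType) (A : set R) (F : R -> R)
    (t d : R) : Prop :=
  (F s - F t) / (s - t) @[s --> within A t^'] --> d.

(* Main.v *)
(** Extending [g] by zero below [m] to a function [G] with [G 0 = 0], the right
    hand side becomes the sum of [(G (j - k) - G j) W_{j,k}] with truncated
    subtraction.  As [G] is [C]-Lipschitz, the weight is at most [C min(j, k)],
    and [beta <= 1/2] gives [a_{j,k} <= K max(j, k)], so that the family is
    dominated by [C K (j c_j) (k c_k)], which is summable.  The cut-offs
    [min(G j, C (n - j))] have the same Lipschitz constant and finite support;
    for them the weak form is a finite combination of the mild equations, and
    dominated convergence as [n] tends to infinity gives it for [G] itself.  In
    particular the first moment is Lipschitz in time; together with the
    continuity of the coordinates and a dominated convergence theorem with
    varying bounds, this makes the right hand side continuous, and the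
    fundamental theorem of calculus applies.  The three closed forms follow by
    symmetrizing the weights in [j] and [k]. *)

Require Import Defs.
From mathcomp Require Import all_boot all_order all_algebra.
From mathcomp Require Import all_classical all_reals all_analysis.
From mathcomp Require Import measurable_realfun ring lra zify.
Import Order.TTheory GRing.Theory Num.Theory.
Import numFieldNormedType.Exports.
Set Implicit Arguments.
Unset Strict Implicit.
Unset Printing Implicit Defensive.
Local Open Scope classical_set_scope.
Local Open Scope ring_scope.

(** * Absolutely summable families *)

Section absolute_sums.
Context {R : realType} {I : choiceType}.
Implicit Types (f g h : I -> R) (D : set I).

Lemma esumZl D (a : I -> \bar R) (r : R) : 0 <= r ->
  (forall i, 0 <= a i)%E ->
  (\esum_(i in D) (r%:E * a i) = r%:E * \esum_(i in D) a i)%E.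
Proof.
move=> r0 a0; rewrite /esum -ereal_supZl//; last first.
  apply/set0P; exists (\sum_(x \in set0) a x)%E; exists set0 => //.
  exact: fsets_set0.
rewrite image_comp; congr ereal_sup; apply: eq_imagel => X [finX XD] /=.
by rewrite ge0_mule_fsumr.
Qed.

Definition asummable f := summable [set: I] (EFin \o f).

(* Meaningful only if [asummable f], as [fine] sends infinite values to 0. *)
Definition rsum f : R := fine (signed_esum [set: I] f).

Lemma asummable_le f g : (forall i, `|f i| <= `|g i|) ->
  asummable g -> asummable f.
Proof.
by move=> fg; apply: le_lt_trans; apply: le_esum => i _ /=; rewrite lee_fin.
Qed.

Lemma asummable_dom f h : (forall i, `|f i| <= h i) ->
  asummable h -> asummable f.
Proof.
by move=> fh; apply: asummable_le => i; rewrite (le_trans (fh i))// ler_norm.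
Qed.

Lemma asummableD f g : asummable f -> asummable g ->
  asummable (fun i => f i + g i).
Proof. exact: summableD. Qed.

Lemma asummableN f : asummable f -> asummable (fun i => - f i).
Proof. by apply: asummable_le => i; rewrite normrN. Qed.

Lemma asummableB f g : asummable f -> asummable g ->
  asummable (fun i => f i - g i).
Proof. exact: summableB. Qed.

Lemma asummableZ r f : asummable f -> asummable (fun i => r * f i).
Proof.
rewrite /asummable /summable => fs.
rewrite (@eq_esum _ _ _ _ (fun i => `|r|%:E * `|(EFin \o f) i|)%E)//.
  rewrite esumZl//; apply: lte_mul_pinfty => //.
by move=> i _ /=; rewrite normrM EFinM.
Qed.

Lemma asummable_sum (J : Type) (s : seq J) (f : J -> I -> R) :
  (forall j, asummable (f j)) -> asummable (fun i => \sum_(j <- s) f j i).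
Proof.
move=> fs; elim: s => [|j s IHs].
  rewrite /asummable /summable esum1// => i _ /=.
  by rewrite big_nil normr0.
apply: (@asummable_le _ (fun i => f j i + \sum_(j <- s) f j i)).
  by move=> i; rewrite big_cons.
exact: asummableD.
Qed.

Lemma esum_fin_num h : (forall i, 0 <= h i) -> asummable h ->
  (\esum_(i in [set: I]) (h i)%:E)%E \is a fin_num.
Proof.
move=> h0; rewrite /asummable summableE.
by under eq_esum do rewrite /= ger0_norm//.
Qed.

(** Any splitting into nonnegative summable parts may replace the positive and negative parts. The
    one used below is [|f|] and [|f| - f], which are nonnegative and summable as soon as [f] is
    summable. *)
Lemma rsum_split f g h : asummable g -> asummable h ->
  (forall i, 0 <= g i) -> (forall i, 0 <= h i) ->
  (forall i, f i = g i - h i) ->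
  (signed_esum [set: I] f =
   \esum_(i in [set: I]) (g i)%:E - \esum_(i in [set: I]) (h i)%:E)%E.
Proof.
move=> gs hs g0 h0 fE; rewrite -esumB//; last 2 first.
- by move=> i _; rewrite lee_fin.
- by move=> i _; rewrite lee_fin.
rewrite /signed_esum; congr (_ - _)%E; apply: eq_esum => i _.
- by rewrite !funeposE /= fE.
- by rewrite !funenegE /= fE.
Qed.

Lemma signed_esum_ge0 h : (forall i, 0 <= h i) -> asummable h ->
  (signed_esum [set: I] h = \esum_(i in [set: I]) (h i)%:E)%E.
Proof.
move=> h0 hs; rewrite (@rsum_split _ h (cst 0))//.
- by rewrite [X in (_ - X)%E]esum1// sube0.
- by apply: (asummable_le _ hs) => i /=; rewrite normr0.
- by move=> i /=; rewrite subr0.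
Qed.

Lemma rsum_ge0E h : (forall i, 0 <= h i) -> asummable h ->
  ((rsum h)%:E = \esum_(i in [set: I]) (h i)%:E)%E.
Proof.
by move=> h0 hs; rewrite /rsum signed_esum_ge0// fineK// esum_fin_num.
Qed.

Lemma rsum_splitE f g h : asummable g -> asummable h ->
  (forall i, 0 <= g i) -> (forall i, 0 <= h i) ->
  (forall i, f i = g i - h i) -> rsum f = rsum g - rsum h.
Proof.
move=> gs hs g0 h0 fE; rewrite {1}/rsum (rsum_split gs hs)//.
by rewrite -!rsum_ge0E.
Qed.

(** Finiteness of the signed sum: under summability, [fine] loses nothing in [rsum]. *)
Lemma signed_esumTE f : asummable f -> signed_esum [set: I] f = (rsum f)%:E.
Proof.
move=> fs; have E : forall i, f i = `|f i| - (`|f i| - f i).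
  by move=> i; ring.
have s1 : asummable (fun i => `|f i|).
  by apply: asummable_le fs => i; rewrite normr_id.
have s2 : asummable (fun i => `|f i| - f i) by exact: asummableB.
have p i : 0 <= `|f i| - f i by rewrite subr_ge0 ler_norm.
by rewrite (rsum_splitE s1 s2)// (rsum_split s1 s2)// EFinB !rsum_ge0E.
Qed.

Lemma eq_rsum f g : f =1 g -> rsum f = rsum g.
Proof. by move=> /funext ->. Qed.

Lemma rsum_eq0 f : (forall i, f i = 0) -> rsum f = 0.
Proof.
move=> f0; rewrite /rsum /signed_esum !esum1 ?subee//= => i _.
  by rewrite funenegE /= f0 oppr0 maxxx.
by rewrite funeposE /= f0 maxxx.
Qed.

Lemma rsumD_ge0 g h : asummable g -> asummable h ->
  (forall i, 0 <= g i) -> (forall i, 0 <= h i) ->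
  rsum (fun i => g i + h i) = rsum g + rsum h.
Proof.
move=> gs hs g0 h0; apply/EFin_inj; rewrite EFinD !rsum_ge0E//.
- by rewrite -esumD// => i _; rewrite lee_fin.
- by move=> i; rewrite addr_ge0.
- exact: asummableD.
Qed.

(** Positive parts are not additive, but the splittings [|f| - (|f| - f)] and [|g| - (|g| - g)] add
    up to a splitting of the sum, which reduces the claim to nonnegative families. *)
Lemma rsumD f g : asummable f -> asummable g ->
  rsum (fun i => f i + g i) = rsum f + rsum g.
Proof.
move=> fs gs.
have nrm u : asummable u -> asummable (fun i => `|u i|).
  by apply: asummable_le => i; rewrite normr_id.
have neg u : asummable u -> asummable (fun i => `|u i| - u i).
  by move=> us; apply: asummableB => //; exact: nrm.
have p (u : I -> R) : (forall i, 0 <= `|u i| - u i) by move=> i;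
    rewrite subr_ge0 ler_norm.
have sE u : asummable u -> rsum u = rsum (fun i => `|u i|) - rsum (fun i => `|u
    i| - u i).
  by move=> us; apply: rsum_splitE => // [||i]; [exact: nrm|exact: neg|ring].
rewrite (sE f)// (sE g)//.
rewrite (@rsum_splitE _ (fun i => `|f i| + `|g i|)
   (fun i => (`|f i| - f i) + (`|g i| - g i))).
- rewrite (rsumD_ge0 (nrm _ fs) (nrm _ gs))//.
  by rewrite (rsumD_ge0 (neg _ fs) (neg _ gs))//; ring.
- by apply: asummableD; exact: nrm.
- by apply: asummableD; exact: neg.
- by move=> i; rewrite addr_ge0.
- by move=> i; rewrite addr_ge0.
- by move=> i; ring.
Qed.

Lemma rsumN f : asummable f -> rsum (fun i => - f i) = - rsum f.
Proof.
move=> fs; apply/eqP; rewrite -addr_eq0 -rsumD//; last exact: asummableN.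
by rewrite rsum_eq0// => i; rewrite addNr.
Qed.

Lemma rsumB f g : asummable f -> asummable g ->
  rsum (fun i => f i - g i) = rsum f - rsum g.
Proof. by move=> fs gs; rewrite -rsumN// rsumD//; exact: asummableN. Qed.

Lemma rsumZ r f : asummable f -> rsum (fun i => r * f i) = r * rsum f.
Proof.
have ge0 s u : 0 <= s -> (forall i, 0 <= u i) -> asummable u ->
    rsum (fun i => s * u i) = s * rsum u.
  move=> s0 u0 us; apply/EFin_inj; rewrite EFinM !rsum_ge0E//.
  - by rewrite -esumZl// => i; rewrite lee_fin.
  - by move=> i; rewrite mulr_ge0.
  - exact: asummableZ.
have pos s u : 0 <= s -> asummable u -> rsum (fun i => s * u i) = s * rsum u.
  move=> s0 us.
  have nu : asummable (fun i => `|u i|).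
    by apply: asummable_le us => i; rewrite normr_id.
  have pu : asummable (fun i => `|u i| - u i) by exact: asummableB.
  have p i : 0 <= `|u i| - u i by rewrite subr_ge0 ler_norm.
  rewrite [in RHS](@rsum_splitE _ (fun i => `|u i|) (fun i => `|u i| - u i))//;
    last by move=> i; ring.
  rewrite mulrBr -!ge0// -rsumB; [|exact: asummableZ..].
  by apply: eq_rsum => i; ring.
move=> fs; have [r0|r0] := leP 0 r; first exact: pos.
rewrite (@eq_rsum _ (fun i => - (- r * f i))); last by move=> i; ring.
rewrite rsumN; last exact: asummableZ.
by rewrite pos// ?oppr_ge0 ?(ltW r0)// mulNr opprK.
Qed.

Lemma rsum_sum (J : Type) (s : seq J) (f : J -> I -> R) :
  (forall j, asummable (f j)) ->
  rsum (fun i => \sum_(j <- s) f j i) = \sum_(j <- s) rsum (f j).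
Proof.
move=> fs; elim: s => [|j s IHs].
  by rewrite big_nil rsum_eq0// => i; rewrite big_nil.
rewrite big_cons -IHs -rsumD//; last exact: asummable_sum.
by apply: eq_rsum => i; rewrite big_cons.
Qed.

Lemma rsum_ge0 h : (forall i, 0 <= h i) -> 0 <= rsum h.
Proof.
move=> h0; rewrite /rsum /signed_esum [X in (_ - X)%E]esum1 ?sube0.
  by rewrite fine_ge0// esum_ge0// => i _; exact: funepos_ge0.
by move=> i _; rewrite funenegE /=; apply/max_idPr; rewrite lee_fin oppr_le0.
Qed.

Lemma ler_rsum f g : asummable f -> asummable g -> (forall i, f i <= g i) ->
  rsum f <= rsum g.
Proof.
move=> fs gs fg; rewrite -subr_ge0 -rsumB// rsum_ge0// => i.
by rewrite subr_ge0.
Qed.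

Lemma ler_norm_rsum f h : asummable h -> (forall i, `|f i| <= h i) ->
  `|rsum f| <= rsum h.
Proof.
move=> hs fh; have fs : asummable f by exact: asummable_dom hs.
rewrite ler_norml -rsumN//; apply/andP; split; apply: ler_rsum => //.
- exact: asummableN.
- by move=> i; have := fh i; rewrite ler_norml => /andP[].
- by move=> i; have := fh i; rewrite ler_norml => /andP[].
Qed.

Lemma rsum_single i0 f : (forall i, i != i0 -> f i = 0) -> rsum f = f i0.
Proof.
have pos h : (forall i, 0 <= h i) -> (forall i, i != i0 -> h i = 0) ->
    (\esum_(i in [set: I]) (h i)%:E)%E = (h i0)%:E.
  move=> h0 hi0; rewrite -(@esum_set1 _ _ i0 (fun i => (h i)%:E));
      last by rewrite lee_fin.
  rewrite [RHS]esum_mkcond; apply: eq_esum => i _.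
  case: ifPn => //; rewrite notin_setE /= => /eqP ni.
  by rewrite hi0//.
have posS h : (forall i, 0 <= h i) -> (forall i, i != i0 -> h i = 0) ->
   asummable h.
  move=> h0 hi0; rewrite /asummable /summable.
  by under eq_esum do rewrite /= ger0_norm//; rewrite pos// ltry.
move=> f0.
have z i : i != i0 -> `|f i| = 0 by move=> /f0 ->; rewrite normr0.
have z' i : i != i0 -> `|f i| - f i = 0 by move=> /f0 ->; rewrite normr0 subr0.
have p i : 0 <= `|f i| - f i by rewrite subr_ge0 ler_norm.
rewrite (@rsum_splitE _ (fun i => `|f i|) (fun i => `|f i| - f i))//.
- have s1 : asummable (fun i => `|f i|) by exact: posS.
  have s2 : asummable (fun i => `|f i| - f i) by exact: posS.
  have -> : rsum (fun i => `|f i|) = `|f i0|.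
    by apply/EFin_inj; rewrite rsum_ge0E// pos.
  have -> : rsum (fun i => `|f i| - f i) = `|f i0| - f i0.
    by apply/EFin_inj; rewrite rsum_ge0E// pos.
  by ring.
- exact: posS.
- exact: posS.
- by move=> i; ring.
Qed.

(** The remainder stays a family on the same index type, so that heads and tails can be estimated
    separately in [rsum_cvg]. *)
Lemma rsum_off f (s : seq I) : uniq s -> asummable f ->
  rsum f = \sum_(i <- s) f i + rsum (fun i => if i \in s then 0 else f i).
Proof.
move=> us fs; elim: s us => [_|j s IHs /= /andP[js us]].
  by rewrite big_nil add0r; apply: eq_rsum.
have sub (P : pred I) : asummable (fun i => if P i then 0 else f i).
  by apply: asummable_le fs => i; case: ifP; rewrite ?normr0.
rewrite IHs// big_cons [f j + _]addrC -addrA; congr (_ + _).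
have -> : f j = rsum (fun i => if i != j then 0 else f i).
  by rewrite (@rsum_single j) ?eqxx// => i ->.
rewrite -rsumD//; apply: eq_rsum => i; rewrite inE.
by case: eqVneq => [->|_]/=; rewrite ?(negbTE js) ?addr0 ?add0r.
Qed.

(** The sum is a supremum of finite partial sums, so some finite set comes within [e] of it. *)
Lemma rsum_tail h (e : R) : asummable h -> (forall i, 0 <= h i) -> 0 < e ->
  exists2 s : seq I, uniq s & rsum (fun i => if i \in s then 0 else h i) < e.
Proof.
move=> hs h0 e0.
have : ((rsum h - e)%:E < \esum_(i in [set: I]) (h i)%:E)%E.
  by rewrite -rsum_ge0E// lte_fin gtrBl.
rewrite /esum => /ereal_sup_gt[_ [X [finX _] <-]].
rewrite fsbig_finite//= sumEFin lte_fin => lt.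
have us := finmap.fset_uniq (fset_set X).
exists (finmap.enum_fset (fset_set X)) => //.
by move: lt; rewrite (rsum_off us hs); lra.
Qed.

(* Pratt's form of dominated convergence: the bound may vary with [t] provided
   that its sums converge. *)
Lemma rsum_cvg (T : Type) (F : set_system T) {FF : Filter F}
    (f h : T -> I -> R) (f0 h0 : I -> R) :
  (forall t, asummable (h t)) -> asummable h0 ->
  (forall t i, `|f t i| <= h t i) -> (forall i, `|f0 i| <= h0 i) ->
  (forall i, f t i @[t --> F] --> f0 i) ->
  (forall i, h t i @[t --> F] --> h0 i) ->
  rsum (h t) @[t --> F] --> rsum h0 ->
  rsum (f t) @[t --> F] --> rsum f0.
Proof.
move=> hs h0s fh f0h0 ff0 hh0 sh; apply/cvgrPdist_lt => e e0.
have e4 : 0 < e / 4 by rewrite divr_gt0.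
have h00 i : 0 <= h0 i by exact: le_trans (f0h0 i).
have ht0 t i : 0 <= h t i by exact: le_trans (fh t i).
have [s us tail] := rsum_tail h0s h00 e4.
have cf : \sum_(i <- s) f t i @[t --> F] --> \sum_(i <- s) f0 i.
  by apply: cvg_big => //; exact: add_continuous.
have ch : \sum_(i <- s) h t i @[t --> F] --> \sum_(i <- s) h0 i.
  by apply: cvg_big => //; exact: add_continuous.
(* Tails of the bounds converge, being differences of totals and heads. The tail of [h t] is thus
   eventually below [e / 2], which with [e / 4] for the head and [e / 4] for the tail of [h0] makes
   [e]. *)
have ct : rsum (h t) - \sum_(i <- s) h t i @[t --> F] -->
    rsum h0 - \sum_(i <- s) h0 i by exact: cvgB.
near=> t.
have c1 : `|\sum_(i <- s) f0 i - \sum_(i <- s) f t i| < e / 4.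
  by near: t; move/cvgrPdist_lt : cf; apply.
have c2 : `|(rsum h0 - \sum_(i <- s) h0 i) - (rsum (h t) - \sum_(i <- s) h t
    i)| < e / 4.
  by near: t; move/cvgrPdist_lt : ct; apply.
have f0s : asummable f0 by exact: asummable_dom h0s.
have fts : asummable (f t) by exact: asummable_dom (hs t).
have sub u : asummable u -> asummable (fun i => if i \in s then 0 else u i).
  by apply: asummable_le => i; case: ifP; rewrite ?normr0.
have b0 : `|rsum (fun i => if i \in s then 0 else f0 i)| <=
    rsum (fun i => if i \in s then 0 else h0 i).
  by apply: ler_norm_rsum => [|i]; [exact: sub|case: ifP; rewrite ?normr0].
have bt : `|rsum (fun i => if i \in s then 0 else f t i)| <=
    rsum (fun i => if i \in s then 0 else h t i).
  by apply: ler_norm_rsum => [|i]; [exact: sub|case: ifP; rewrite ?normr0].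
rewrite (rsum_off us f0s) (rsum_off us fts).
rewrite (rsum_off us h0s) (rsum_off us (hs t)) in c2.
move: c1 c2 b0 bt tail; rewrite !ltr_norml !ler_norml.
move=> /andP[? ?] /andP[? ?] /andP[? ?] /andP[? ?] ?.
by apply/andP; split; lra.
Unshelve. all: by end_near. Qed.

Lemma rsum_cvg_dom (T : Type) (F : set_system T) {FF : Filter F}
    (f : T -> I -> R) (f0 h : I -> R) : asummable h ->
  (forall t i, `|f t i| <= h i) -> (forall i, `|f0 i| <= h i) ->
  (forall i, f t i @[t --> F] --> f0 i) ->
  rsum (f t) @[t --> F] --> rsum f0.
Proof.
move=> hs fh f0h ff0.
by apply: (@rsum_cvg _ _ _ _ (fun=> h) _ h) => // *; exact: cvg_cst.
Qed.

(** Extension by zero outside [D]; it brings sums over index sets such as [S1] under the calculus of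
    [rsum]. *)
Lemma signed_esum_rsum D f : summable D (EFin \o f) ->
  signed_esum D f = (rsum (fun i => if i \in D then f i else 0))%:E.
Proof.
move=> fs; rewrite -signed_esumTE.
  rewrite /signed_esum esum_mkcond [X in (_ - X)%E]esum_mkcond.
  by congr (_ - _)%E; apply: eq_esum => i _;
     rewrite ?funeposE ?funenegE /=; case: ifP => //; rewrite ?oppr0 maxxx.
move: fs; rewrite /asummable /summable esum_mkcond.
by apply: le_lt_trans; apply: le_esum => i _ /=; case: ifP => //;
    rewrite normr0.
Qed.

Lemma esum_rsum D f : asummable (fun i => if i \in D then f i else 0) ->
  (forall i, D i -> 0 <= f i) ->
  (\esum_(i in D) (f i)%:E)%E = (rsum (fun i => if i \in D then f i else 0))%:E.
Proof.
move=> fs f0; rewrite rsum_ge0E//.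
  by rewrite esum_mkcond; apply: eq_esum => i _; case: ifP.
by move=> i; case: ifPn => //; rewrite inE; exact: f0.
Qed.

End absolute_sums.

(** * Reindexing, symmetrization and products of sums *)

Section reindexing.
Context {R : realType}.

Lemma esum_reindex (I J : choiceType) (e : I -> J) (a : J -> \bar R) :
  injective e -> (forall j, ~ range e j -> a j = 0%E) ->
  (\esum_(j in [set: J]) a j = \esum_(i in [set: I]) a (e i))%E.
Proof.
move=> einj a0; rewrite -(@esum_image _ _ _ [set: I] e a);
    last by move=> x y _ _; exact: einj.
rewrite [RHS]esum_mkcond; apply: eq_esum => j _.
by case: ifPn => //; rewrite notin_setE => /a0.
Qed.

Lemma asummable_reindex (I J : choiceType) (e : I -> J) (f : J -> R) :
  injective e -> (forall j, ~ range e j -> f j = 0) ->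
  asummable f <-> asummable (f \o e).
Proof.
move=> einj f0; rewrite /asummable /summable (esum_reindex einj)// => j nj.
by rewrite /= f0// normr0.
Qed.

Lemma rsum_reindex (I J : choiceType) (e : I -> J) (f : J -> R) :
  injective e -> (forall j, ~ range e j -> f j = 0) ->
  rsum f = rsum (f \o e).
Proof.
move=> einj f0; rewrite /rsum /signed_esum.
congr (fine (_ - _)%E); rewrite (esum_reindex einj) => [|j nj].
- by apply: eq_esum => i _; rewrite !funeposE.
- by rewrite funeposE /= f0// maxxx.
- by apply: eq_esum => i _; rewrite !funenegE.
- by rewrite funenegE /= f0// oppr0 maxxx.
Qed.

Lemma rsum_swap (I : choiceType) (f : I * I -> R) :
  rsum f = rsum (fun p => f (p.2, p.1)).
Proof.
apply: (@rsum_reindex _ _ (fun p : I * I => (p.2, p.1))).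
  by move=> [? ?] [? ?] [-> ->].
by move=> [i j] []; exists (j, i).
Qed.

(** Exchanging the two indices does not change a sum, so the symmetrized family sums to twice the
    original; the factor 2 is then cancelled. *)
Lemma eq_rsum_swap (I : choiceType) (f g : I * I -> R) :
  asummable f -> asummable g ->
  (forall p, f p + f (p.2, p.1) = g p + g (p.2, p.1)) -> rsum f = rsum g.
Proof.
have swap_inj : injective (fun p : I * I => (p.2, p.1)).
  by move=> [? ?] [? ?] [-> ->].
have swap_off (h : I * I -> R) p : ~ range (fun p : I * I => (p.2, p.1)) p -> h
    p = 0.
  by case: p => i j []; exists (j, i).
have sym (h : I * I -> R) : asummable h -> rsum (fun p => h p + h (p.2, p.1)) =
    2 * rsum h.
  move=> hs; rewrite rsumD//; last exact/(asummable_reindex swap_inj (swap_off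
      h)).
  by rewrite -(rsum_swap h) mulr_natl mulr2n.
move=> fs gs fg; apply: (@mulfI _ 2); first by rewrite pnatr_eq0.
by rewrite -!sym//; exact: eq_rsum.
Qed.

Lemma esum_prod (I J : choiceType) (u : I -> R) (v : J -> R) :
  (forall i, 0 <= u i) -> (forall j, 0 <= v j) -> asummable u -> asummable v ->
  (\esum_(p in [set: I * J]) (u p.1 * v p.2)%:E = (rsum u * rsum v)%:E)%E.
Proof.
move=> u0 v0 us vs.
have -> : [set: I * J] = [set: I] `*`` (fun=> [set: J]) by apply/seteqP; split.
rewrite -(@esum_esum _ _ _ _ _ (fun i j => (u i * v j)%:E)); last first.
  by move=> i j _ _; rewrite lee_fin mulr_ge0.
rewrite mulrC EFinM [X in (_ * X)%E]rsum_ge0E//.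
rewrite -esumZl; [|exact: rsum_ge0|by move=> i; rewrite lee_fin].
apply: eq_esum => i _; rewrite muleC rsum_ge0E// -esumZl//.
Qed.

Lemma asummable_prod (I J : choiceType) (u : I -> R) (v : J -> R) :
  asummable u -> asummable v -> asummable (fun p : I * J => u p.1 * v p.2).
Proof.
move=> us vs; rewrite /asummable /summable.
have nrm (K : choiceType) (w : K -> R) : asummable w -> asummable (fun i => `|w
    i|).
  by apply: asummable_le => i; rewrite normr_id.
under eq_esum do rewrite /= normrM.
rewrite (@esum_prod _ _ (fun i => `|u i|) (fun j => `|v j|)) ?ltry//;
    exact: nrm.
Qed.

Lemma rsum_prod (I J : choiceType) (u : I -> R) (v : J -> R) :
  (forall i, 0 <= u i) -> (forall j, 0 <= v j) -> asummable u -> asummable v ->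
  rsum (fun p : I * J => u p.1 * v p.2) = rsum u * rsum v.
Proof.
move=> u0 v0 us vs; apply/EFin_inj; rewrite rsum_ge0E ?esum_prod//.
  by move=> i; rewrite mulr_ge0.
exact: asummable_prod.
Qed.

End reindexing.

(** * Series over the natural numbers as unconditional sums *)

Section series_on_nat.
Context {R : realType}.

(** Partial sums are sums of truncations of [u], all dominated by [|u|], so dominated convergence
    identifies the limit. *)
Lemma cvg_series_rsum (u : nat -> R) (m : nat) (P : pred nat) : asummable u ->
  \sum_(m <= j < n | P j) u j @[n --> \oo] -->
  rsum (fun j => if (m <= j)%N && P j then u j else 0).
Proof.
move=> us; pose f n j := if (m <= j < n)%N && P j then u j else 0.
have fE n : \sum_(m <= j < n | P j) u j = rsum (f n).
  have fs : asummable (f n).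
    by apply: asummable_le us => j; rewrite /f; case: ifP; rewrite ?normr0.
  rewrite (rsum_off (iota_uniq m (n - m)) fs) [X in _ + X]rsum_eq0 ?addr0.
    rewrite big_mkcond /= /index_iota big_seq [RHS]big_seq.
    apply: eq_bigr => j jmn; rewrite /f.
    move: jmn; rewrite mem_index_iota => -> //=.
  move=> j; rewrite mem_index_iota /f; case: ifP => // ->//.
under eq_cvg do rewrite fE.
apply: (rsum_cvg_dom (h := fun j => `|u j|)).
- by apply: asummable_le us => j; rewrite normr_id.
- by move=> n j; rewrite /f; case: ifP; rewrite ?normr0.
- by move=> j; case: ifP; rewrite ?normr0.
- move=> j; apply: cvg_near_cst; near=> n.
  have jn : (j < n)%N by near: n; exact: nbhs_infty_gt.
  by rewrite /f jn andbT.
Unshelve. all: by end_near. Qed.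

Lemma lim_series_rsum (u : nat -> R) (m : nat) (P : pred nat) : asummable u ->
  \big[+%R/0]_(m <= j <oo | P j) u j =
  rsum (fun j => if (m <= j)%N && P j then u j else 0).
Proof. by move=> us; apply/cvg_lim => //; exact: cvg_series_rsum. Qed.

Lemma nneseries_esum_from (m : nat) (P : pred nat) (a : nat -> \bar R) :
  (forall j, (m <= j)%N -> P j -> 0 <= a j)%E ->
  (\sum_(m <= j <oo | P j) a j =
   \esum_(j in [set j | (m <= j)%N && P j]) a j)%E.
Proof.
move=> a0; rewrite eseries_cond nneseries_esum.
  by congr (esum _ _); apply/seteqP; split => j /=; rewrite andbC.
by move=> j /andP[? ?]; exact: a0.
Qed.

(** The inner starting index may depend on [j], which covers the triangular sum over [k > j]. Only
    the masked family [f] is constrained, so [u] is free outside the range of summation. *)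
Lemma nneseries2_rsum (m : nat) (n : nat -> nat) (P Q : pred nat)
    (u : nat -> nat -> R) :
  let f p := if [&& (m <= p.1)%N, P p.1, (n p.1 <= p.2)%N & Q p.2]
             then u p.1 p.2 else 0 in
  (forall p, 0 <= f p) -> asummable f ->
  (\sum_(m <= j <oo | P j) \sum_(n j <= k <oo | Q k) (u j k)%:E =
   (rsum f)%:E)%E.
Proof.
move=> f f0 fs.
have u0 j k : (m <= j)%N -> P j -> (n j <= k)%N -> Q k -> (0 <= (u j k)%:E)%E.
  by move=> h1 h2 h3 h4; have := f0 (j, k); rewrite /f /= h1 h2 h3 h4.
have i0 j : (m <= j)%N -> P j -> (0 <= \sum_(n j <= k <oo | Q k) (u j k)%:E)%E.
  move=> mj Pj; rewrite nneseries_esum_from; last by move=> k ? ?; exact: u0.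
  by apply: esum_ge0 => k /andP[? ?]; exact: u0.
rewrite nneseries_esum_from//.
rewrite (@eq_esum _ _ _ _ (fun j =>
  \esum_(k in [set k | (n j <= k)%N && Q k]) (u j k)%:E)%E); last first.
  by move=> j /andP[mj Pj]; rewrite nneseries_esum_from// => k ? ?; exact: u0.
rewrite esum_esum; last by move=> j k /andP[? ?] /andP[? ?]; exact: u0.
rewrite rsum_ge0E// esum_mkcond; apply: eq_esum => -[j k] _ /=.
rewrite /f /=; case: ifPn.
  by rewrite inE => -[/= /andP[-> ->] /andP[-> ->]].
rewrite notin_setE /= => nh; case: ifPn => // /and4P[h1 h2 h3 h4].
by exfalso; apply: nh; split => /=; rewrite ?h1 ?h2 ?h3.
Qed.

End series_on_nat.

(** * The weak form of the RBK system *)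

(** [Phi] has a two-sided derivative at [t], even if [t] is an endpoint of [A]. On [A] the
    difference quotients of [F] and [Phi] coincide, and the punctured neighborhoods within [A] form
    a finer filter. *)
Lemma has_derivative_within_primitive (R : realType) (A : set R)
    (F Phi : R -> R) (t d r : R) :
  A t -> (forall s, A s -> F s = r + Phi s) ->
  derivable Phi t 1 -> (Phi^`())%classic t = d -> has_derivative_within A F t d.
Proof.
move=> At FE dPhi PhiE.
have c1 : h^-1 *: (Phi (h + t) - Phi t) @[h --> 0^'] --> d.
  rewrite -PhiE derive1E /derive.
  move: dPhi; rewrite /derivable => /cvg_ex[l lP].
  have E : (fun h : R => h^-1 *: (Phi (h + t) - Phi t)) =
      (fun h : R => h^-1 *: ((Phi \o shift t) (h *: 1) - Phi t)).
    by apply/funext => h /=; rewrite [h *: 1]mulr1.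
  by rewrite E (cvg_lim _ lP).
have c2 : (s - t) @[s --> t^'] --> 0^'.
  move=> P; rewrite /dnbhs /within /= => P0.
  have : (s - t) @[s --> t] --> (0 : R).
    by rewrite -[X in _ --> X](subrr t); apply: cvgB;
        [exact: cvg_id|exact: cvg_cst].
  move=> /(_ _ P0) nP; apply: (@filterS _ (nbhs t) _ _ _ _ nP) => s /= h st.
  by apply: h; rewrite subr_eq0.
have c3 : (Phi s - Phi t) / (s - t) @[s --> t^'] --> d.
  have := cvg_comp _ _ c2 c1.
  by apply: cvg_trans; apply: near_eq_cvg; near=> s => /=;
      rewrite subrK [RHS]mulrC.
rewrite /has_derivative_within.
have : (Phi s - Phi t) / (s - t) @[s --> within A t^'] --> d.
  exact: (cvg_trans (cvg_app _ (cvg_within _)) c3).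
apply: cvg_trans; apply: near_eq_cvg; near=> s.
have As : A s by near: s; exact: withinT.
by rewrite !FE// opprD addrACA subrr add0r.
Unshelve. all: by end_near. Qed.

Lemma measurable_rsum (R : realType) (u : R -> nat -> R) :
  (forall j, continuous (fun s => u s j)) -> (forall s, asummable (u s)) ->
  measurable_fun [set: R] (fun s => rsum (u s)).
Proof.
move=> uc us.
apply: (@measurable_fun_cvg _ _ _ _ (fun n s => \sum_(0 <= j < n | true) u s
    j)).
  move=> n; under eq_fun do rewrite big_mkcond /=.
  by apply: measurable_sum => j; exact: continuous_measurable_fun.
by move=> s _; have /= := @cvg_series_rsum _ (u s) 0 xpredT (us s).
Qed.

(** * Domination of the coagulation matrix *)

Section weak_form.
Context {R : realType}.
Variables (a : nat -> nat -> R) (K : R) (x : R -> nat -> R).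
Hypothesis K_ge0 : 0 <= K.
Hypothesis a_sym : forall j k, (0 < j)%N -> (0 < k)%N -> a j k = a k j.
Hypothesis a_ge0 : forall j k, (0 < j)%N -> (0 < k)%N -> 0 <= a j k.
Hypothesis a_le : forall j k, (0 < j)%N -> (0 < k)%N ->
  a j k <= K * (maxn j k)%:R.
Hypothesis x_ge0 : forall s j, 0 <= x s j.
Hypothesis x0 : forall s, x s 0%N = 0.
Hypothesis x_summable : forall s, asummable (fun j => j%:R * x s j).
Hypothesis x_continuous : forall j, continuous (fun s => x s j).

Definition mass (s : R) : R := rsum (fun j => j%:R * x s j).

Definition coag (s : R) (p : nat * nat) : R := W a (x s) p.1 p.2.

Definition rate (phi : nat * nat -> R) (s : R) : R :=
  rsum (fun p => phi p * coag s p).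

Definition dominated_weight (C : R) (phi : nat * nat -> R) : Prop :=
  forall p, `|phi p| <= C * (minn p.1 p.2)%:R.

Lemma coag_eq0 s p : (p.1 == 0)%N || (p.2 == 0)%N -> coag s p = 0.
Proof.
case: p => j k; rewrite /coag /W /=.
by case/orP => /eqP ->; rewrite x0 ?mulr0 ?mul0r.
Qed.

Lemma coag_ge0 s p : 0 <= coag s p.
Proof.
have [/coag_eq0 ->//|] := boolP ((p.1 == 0) || (p.2 == 0))%N.
rewrite negb_or -!lt0n => /andP[p1 p2].
by rewrite /coag /W !mulr_ge0// a_ge0.
Qed.

Lemma coag_swap s p : coag s (p.2, p.1) = coag s p.
Proof.
case: p => j k; have [h|] := boolP ((j == 0) || (k == 0))%N.
  by rewrite !coag_eq0//= orbC.
rewrite negb_or -!lt0n => /andP[p1 p2].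
by rewrite /coag /W /= a_sym// mulrAC.
Qed.

(** Since [j * k = minn j k * maxn j k], a weight of size [minn j k] together with the kernel bound
    [a_le] gives the product of two first-moment terms. *)
Lemma minn_coag_le s p : (minn p.1 p.2)%:R * coag s p <=
  K * ((p.1%:R * x s p.1) * (p.2%:R * x s p.2)).
Proof.
case: p => j k /=; have [h|] := boolP ((j == 0) || (k == 0))%N.
  by rewrite coag_eq0// mulr0 !mulr_ge0.
rewrite negb_or -!lt0n => /andP[j0 k0].
have -> : K * (j%:R * x s j * (k%:R * x s k)) =
    (minn j k)%:R * (K * (maxn j k)%:R) * (x s j * x s k).
  have -> : j%:R * x s j * (k%:R * x s k) = (j * k)%:R * (x s j * x s k).
    by rewrite natrM; ring.
  have -> : (j * k = minn j k * maxn j k)%N by rewrite /minn /maxn;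
      case: ltnP; lia.
  by rewrite natrM; ring.
rewrite /coag /W /= -[_ * x s k]mulrA -[leRHS]mulrA ler_wpM2l//.
by rewrite ler_wpM2r ?mulr_ge0// a_le.
Qed.

Lemma weighted_coag_le C phi s p : 0 <= C -> dominated_weight C phi ->
  `|phi p * coag s p| <=
  C * K * ((p.1%:R * x s p.1) * (p.2%:R * x s p.2)).
Proof.
move=> C0 phiC; rewrite normrM (ger0_norm (coag_ge0 _ _)).
apply: (@le_trans _ _ (C * ((minn p.1 p.2)%:R * coag s p))).
  by rewrite [leRHS]mulrA ler_wpM2r ?coag_ge0.
by rewrite -[leRHS]mulrA ler_wpM2l// minn_coag_le.
Qed.

Lemma asummable_bound (C : R) s : asummable (fun p : nat * nat =>
  C * K * ((p.1%:R * x s p.1) * (p.2%:R * x s p.2))).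
Proof. exact: (asummableZ _ (asummable_prod (x_summable s) (x_summable s))).
    Qed.

Lemma rsum_bound (C : R) s : rsum (fun p : nat * nat =>
  C * K * ((p.1%:R * x s p.1) * (p.2%:R * x s p.2))) = C * K * mass s ^+ 2.
Proof.
rewrite rsumZ; last exact: (asummable_prod (x_summable s) (x_summable s)).
have y_ge0 j : 0 <= j%:R * x s j by rewrite mulr_ge0.
by rewrite (rsum_prod y_ge0 y_ge0 (x_summable s) (x_summable s)).
Qed.

Lemma weighted_coag_summable C phi s : 0 <= C -> dominated_weight C phi ->
  asummable (fun p => phi p * coag s p).
Proof.
move=> C0 phiC; apply: (asummable_dom _ (asummable_bound C s)) => p.
exact: weighted_coag_le.
Qed.

Lemma rate_le C phi s : 0 <= C -> dominated_weight C phi ->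
  `|rate phi s| <= C * K * mass s ^+ 2.
Proof.
move=> C0 phiC; rewrite -rsum_bound; apply: ler_norm_rsum => [|p].
  exact: asummable_bound.
exact: weighted_coag_le.
Qed.

Lemma coag_continuous p : continuous (fun s => coag s p).
Proof.
move=> s; rewrite /coag /W; apply: cvgM; last exact: x_continuous.
by apply: cvgM; [exact: cvg_cst|exact: x_continuous].
Qed.

(** The dominating family itself depends on time. Its sum is [C * K * mass s ^+ 2], so continuity of
    [mass] is exactly the convergence of bounds that [rsum_cvg] asks for. *)
Lemma rate_continuous C phi : 0 <= C -> dominated_weight C phi ->
  continuous mass -> continuous (rate phi).
Proof.
move=> C0 phiC Nc s.
have yc j : (j%:R * x t j) @[t --> s] --> j%:R * x s j.
  by apply: cvgM; [exact: cvg_cst|exact: x_continuous].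
apply: (rsum_cvg (h := fun t p => C * K * ((p.1%:R * x t p.1) * (p.2%:R * x t
    p.2)))
   (h0 := fun p => C * K * ((p.1%:R * x s p.1) * (p.2%:R * x s p.2)))).
- by move=> t; exact: asummable_bound.
- exact: asummable_bound.
- by move=> t p; exact: weighted_coag_le.
- by move=> p; exact: weighted_coag_le.
- by move=> p; apply: cvgM; [exact: cvg_cst|exact: coag_continuous].
- by move=> p; apply: cvgM; [exact: cvg_cst|apply: cvgM; exact: yc].
- under eq_cvg do rewrite rsum_bound.
  rewrite rsum_bound; apply: cvgM; first exact: cvg_cst.
  by rewrite expr2; under eq_cvg do rewrite expr2; apply: cvgM; exact: Nc.
Qed.

(** * Fluxes of Lipschitz weights and the mild equations *)

(* With truncated subtraction and [G 0 = 0], one formula covers both index sets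
   [S1] and [S2]. *)
Definition flux (G : nat -> R) (p : nat * nat) : R :=
  G (p.1 - p.2)%N - G p.1.

Definition lipschitz_weight (C : R) (G : nat -> R) : Prop :=
  G 0%N = 0 /\ forall i k, `|G (i + k)%N - G i| <= C * k%:R.

(** If [k <= j], the flux is an increment over [k] steps; if [j < k], truncation turns it into
    [G 0 - G j], an increment over [j] steps. *)
Lemma flux_dominated C G : lipschitz_weight C G -> dominated_weight C (flux G).
Proof.
move=> [G0 GC] [j k]; rewrite /flux /=; case: (leqP k j) => kj.
  by rewrite distrC; have := GC (j - k)%N k; rewrite subnK.
rewrite (eqP (ltnW kj : (j - k == 0)%N)).
by rewrite distrC; have := GC 0%N j; rewrite add0n.
Qed.

Lemma id_lipschitz : lipschitz_weight 1 (fun j => j%:R).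
Proof.
by split=> // i k; rewrite natrD addrAC subrr add0r mul1r normr_nat.
Qed.

(** Over at least one step an indicator changes by at most 1. It is applied to singletons, to the
    positive integers and to the odd integers. *)
Lemma indicator_lipschitz (P : pred nat) : ~~ P 0%N ->
  lipschitz_weight 1 (fun j => (P j)%:R).
Proof.
move=> /negbTE P0; split=> [|i [|k]]; first by rewrite P0.
- by rewrite addn0 subrr normr0 mulr0.
- rewrite mul1r (@le_trans _ _ 1)//; last by rewrite ler1n.
  by do 2 case: (P _); rewrite /= ?subrr ?subr0 ?sub0r ?normrN ?normr0 ?normr1.
Qed.

(** The flux of the indicator of [j] contributes [+1] where [p.1 - p.2 = j] and [-1] where
    [p.1 = j]: the gain and loss terms of the [j]-th equation. *)
Definition gain_loss (j : nat) : nat * nat -> R :=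
  flux (fun i => (i == j)%:R).

Lemma gain_loss_dominated j : (0 < j)%N -> dominated_weight 1 (gain_loss j).
Proof.
by move=> j0; apply: flux_dominated; apply: indicator_lipschitz;
    rewrite ltn_eqF.
Qed.

Lemma nneseries1_rsum (u : nat -> R) : asummable u -> (forall k, 0 <= u k) ->
  u 0%N = 0 -> (\sum_(1 <= k <oo) (u k)%:E = (rsum u)%:E)%E.
Proof.
move=> us u_ge0 u0; rewrite nneseries_esum_from; last first.
  by move=> k _ _; rewrite lee_fin.
rewrite rsum_ge0E// esum_mkcond; apply: eq_esum => k _.
case: ifPn => //; rewrite notin_setE /= andbT => /negP.
by rewrite -leqNgt leqn0 => /eqP ->; rewrite u0.
Qed.

Lemma minn_coag_summable s :
  asummable (fun p => (minn p.1 p.2)%:R * coag s p).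
Proof.
apply: (weighted_coag_summable s ler01) => p.
by rewrite mul1r normr_nat.
Qed.

Lemma coag_le_minn s p : coag s p <= (minn p.1 p.2)%:R * coag s p.
Proof.
have [/coag_eq0 ->|] := boolP ((p.1 == 0) || (p.2 == 0))%N;
    first by rewrite mulr0.
rewrite negb_or -!lt0n => /andP[p1 p2].
by rewrite ler_peMl ?coag_ge0// ler1n leq_min p1.
Qed.

(** The weight [minn p.1 p.2] is at least 1 wherever both indices are positive, and [coag] vanishes
    elsewhere, so unweighted sums are controlled too. *)
Lemma coag_summable (P : pred (nat * nat)) s :
  asummable (fun p => if P p then coag s p else 0).
Proof.
apply: (asummable_dom _ (minn_coag_summable s)) => p.
case: ifP => _; first by rewrite ger0_norm ?coag_ge0 ?coag_le_minn.
by rewrite normr0 mulr_ge0// coag_ge0.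
Qed.

(** Treats the gain line [(j + k, k)] and the loss line [(j, k)] at once: a sum over pairs supported
    on the range of [e] collapses to a series in [k]. *)
Let gain_reindex j (e : nat -> nat * nat) (P : pred (nat * nat)) :
  (forall k, e k = (j + k, k)%N) \/ (forall k, e k = (j, k)) ->
  (forall p, P p <-> range e p) -> (0 < j)%N ->
  forall s, [/\ (\sum_(1 <= k <oo) (coag s (e k))%:E =
       (rsum (fun p => if P p then coag s p else 0%R))%:E)%E,
     rsum (fun p => if P p then coag s p else 0) = rsum (fun k => coag s (e k))
         &
     asummable (fun k => coag s (e k))].
Proof.
move=> eE Pe j0 s.
have ei : injective e by move=> k k'; case: eE => E; rewrite !E => -[].
have off p : ~ range e p -> (if P p then coag s p else 0) = 0.
  by move=> np; case: ifP => // /Pe.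
have eP k : P (e k) by apply/Pe; exists k.
have E : (fun p => if P p then coag s p else 0) \o e = (fun k => coag s (e k)).
  by apply/funext => k /=; rewrite eP.
have /(asummable_reindex ei off) := coag_summable P s; rewrite E => es.
split => //; last by rewrite (rsum_reindex ei off) E.
rewrite (rsum_reindex ei off) E nneseries1_rsum// => [k|].
  exact: coag_ge0.
(* On either line [k = 0] yields a pair with second index 0, so a series starting at 1 misses
   nothing. *)
by apply: coag_eq0; case: eE => -> /=; rewrite orbT.
Qed.

Lemma gain_lossE j s : (0 < j)%N ->
  [/\ (\sum_(1 <= k <oo) (W a (x s) (j + k) k)%:E -
   \sum_(1 <= k <oo) (W a (x s) j k)%:E = (rate (gain_loss j) s)%:E)%E,
    rate (gain_loss j) s = rsum (fun k => coag s (j + k, k)%N) -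
                           rsum (fun k => coag s (j, k)),
    asummable (fun k => coag s (j + k, k)%N) &
    asummable (fun k => coag s (j, k))].
Proof.
move=> j0.
(* As [0 < j], the truncated equation [p.1 - p.2 = j] forces [p.1 = j + p.2]. *)
have [||E1 F1 s1] := @gain_reindex j (fun k => (j + k, k)%N) (fun p => (p.1 -
    p.2 == j)%N) _ _ j0 s.
- by left.
- move=> [i k] /=; split => [/eqP ikj|[k' _ [<- <-]]]; last by rewrite addnK.
  by exists k => //; congr pair; lia.
have [||E2 F2 s2] := @gain_reindex j (fun k => (j, k)) (fun p => (p.1 == j)) _
    _ j0 s.
- by right.
- move=> [i k] /=; split => [/eqP ->|[k' _ [-> _]]//]; by exists k.
suff -> : rate (gain_loss j) s = rsum (fun p => if (p.1 - p.2 == j)%N then coag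
    s p else 0) -
   rsum (fun p => if (p.1 == j)%N then coag s p else 0).
  by split; rewrite // ?EFinB -?E1 -?E2 ?F1 ?F2.
rewrite -rsumB.
- apply: eq_rsum => -[i k]; rewrite /gain_loss /flux /=.
  by rewrite mulrBl; congr (_ - _); case: eqP; rewrite ?mul1r ?mul0r.
- exact: coag_summable.
- exact: coag_summable.
Qed.

(** [measurable_rsum] concerns sums over [nat], hence the passage from pairs to the two one-index
    sums of [gain_lossE]. *)
Lemma gain_loss_measurable j : (0 < j)%N ->
  measurable_fun [set: R] (rate (gain_loss j)).
Proof.
move=> j0; rewrite (_ : rate _ = (fun s => rsum (fun k => coag s (j + k, k)%N))
    \-
    (fun s => rsum (fun k => coag s (j, k)))); last first.
  by apply/funext => s; case: (gain_lossE s j0).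
by apply: measurable_funB; apply: measurable_rsum => [k|s];
   try exact: coag_continuous; case: (gain_lossE s j0).
Qed.

(** * Symmetrization and the closed forms *)

(* The weak form of the equation is only determined up to the symmetry of the
   coagulation matrix, so sums are compared after symmetrization. *)
Lemma rate_symmetrize C phi s (f : nat * nat -> R) : 0 <= C ->
  dominated_weight C phi -> asummable f ->
  (forall p, (0 < p.1)%N -> (0 < p.2)%N ->
     (phi p + phi (p.2, p.1)) * coag s p = f p + f (p.2, p.1)) ->
  (forall p, (p.1 == 0)%N || (p.2 == 0)%N -> f p = 0) ->
  rate phi s = rsum f.
Proof.
move=> C0 phiC fs fE f0; apply: eq_rsum_swap => //.
  exact: weighted_coag_summable phiC.
move=> p; rewrite coag_swap -mulrDl.
have [h|] := boolP ((p.1 == 0) || (p.2 == 0))%N.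
  by rewrite coag_eq0// !f0 ?addr0 ?mulr0//= orbC.
by rewrite negb_or -!lt0n => /andP[p1 p2]; exact: fE.
Qed.

(** The flux equals [- minn j k]; by symmetry the half [j < k] counts twice and the diagonal
    once. *)
Lemma rate_id s : rate (flux (fun j => j%:R)) s =
  - (2 * rsum (fun p => if (p.1 < p.2)%N then p.1%:R * coag s p else 0))
  - rsum (fun p => if (p.1 == p.2)%N then p.1%:R * coag s p else 0).
Proof.
have s1 : asummable (fun p => if (p.1 < p.2)%N then p.1%:R * coag s p else 0).
  apply: asummable_le (minn_coag_summable s) => p.
  by case: ltnP; rewrite ?normr0.
have s2 : asummable (fun p => if (p.1 == p.2)%N then p.1%:R * coag s p else 0).
  apply: asummable_le (minn_coag_summable s) => -[j k] /=.
  by case: eqP => [->|]; rewrite ?normr0 ?minnn.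
rewrite -rsumZ// -rsumN; last exact: asummableZ.
rewrite -rsumB//; last by apply: asummableN; exact: asummableZ.
apply: (rate_symmetrize ler01 (flux_dominated id_lipschitz)).
- by apply: asummableB => //; apply: asummableN; exact: asummableZ.
- move=> [j k] /= _ _; rewrite /flux /= (coag_swap s (j, k)).
  case: (ltngtP j k) => [jk|kj|->]; rewrite ?subnn.
  + by rewrite (eqP (ltnW jk : (j - k == 0)%N)) natrB ?(ltnW jk)//; ring.
  + by rewrite (eqP (ltnW kj : (k - j == 0)%N)) natrB ?(ltnW kj)//; ring.
  + by ring.
- by move=> p p0; rewrite coag_eq0// !(mulr0, if_same, oppr0, addr0).
Qed.

(** For positive indices the flux is [-1] if [j <= k] and 0 otherwise; symmetrized, it is [-1] off
    the diagonal and [-2] on it. *)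
Lemma rate_pos s : rate (flux (fun j => (0 < j)%N%:R)) s =
  - (1 / 2 * rsum (coag s))
  - 1 / 2 * rsum (fun p => if (p.1 == p.2)%N then coag s p else 0).
Proof.
have s1 : asummable (coag s) by exact: (coag_summable xpredT).
have s2 : asummable (fun p => if (p.1 == p.2)%N then coag s p else 0).
  exact: coag_summable.
rewrite -!rsumZ// -rsumN; last exact: asummableZ.
rewrite -rsumB; [|by apply: asummableN; exact: asummableZ|exact: asummableZ].
apply: (rate_symmetrize ler01 (flux_dominated (@indicator_lipschitz [pred j | 0
    < j]%N _))) => //.
- by apply: asummableB; [apply: asummableN|]; exact: asummableZ.
- move=> [j k] /= j0 k0; rewrite /flux /= (coag_swap s (j, k)) j0 k0 !subn_gt0.
  by case: ltngtP => _ /=; field.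
- by move=> p p0; rewrite coag_eq0// !(mulr0, if_same, oppr0, addr0).
Qed.

(** For [j > k] the symmetrized flux is [odd (j - k) - odd j - odd k], and the parity of [j - k] is
    the exclusive or of the two parities. This gives [-2] when both indices are odd and 0 otherwise;
    the diagonal follows the same rule. *)
Lemma rate_odd s : rate (flux (fun j => (odd j)%:R)) s =
  - rsum (fun p => if odd p.1 && odd p.2 then coag s p else 0).
Proof.
have s1 : asummable (fun p => if odd p.1 && odd p.2 then coag s p else 0).
  exact: coag_summable.
rewrite -rsumN//.
apply: (rate_symmetrize ler01 (flux_dominated (@indicator_lipschitz odd _))) =>
    //.
- exact: asummableN.
- move=> [j k] /= _ _; rewrite /flux /= (coag_swap s (j, k)) [odd k && _]andbC.
  case: (ltngtP j k) => [jk|kj|->]; rewrite ?subnn.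
  + rewrite (eqP (ltnW jk : (j - k == 0)%N)) oddB ?(ltnW jk)//.
    by case: (odd j); case: (odd k) => /=; ring.
  + rewrite (eqP (ltnW kj : (k - j == 0)%N)) oddB ?(ltnW kj)//.
    by case: (odd j); case: (odd k) => /=; ring.
  + by case: (odd k) => /=; ring.
- by move=> p p0; rewrite coag_eq0// if_same oppr0.
Qed.

Lemma nneseries_diag (u : nat * nat -> R) : (forall p, 0 <= u p) ->
  asummable (fun p => if (p.1 == p.2)%N then u p else 0) -> u (0, 0)%N = 0 ->
  (\sum_(1 <= j <oo) (u (j, j))%:E =
   (rsum (fun p => if (p.1 == p.2)%N then u p else 0))%:E)%E.
Proof.
move=> u_ge0 us u0; pose e (j : nat) := (j, j).
have ei : injective e by move=> i j [].
have off p : ~ range e p -> (if (p.1 == p.2)%N then u p else 0) = 0.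
  by case: p => j k /= np; case: eqP => // jk; case: np; exists j => //;
      rewrite /e jk.
have E : (fun p => if (p.1 == p.2)%N then u p else 0) \o e = (fun j => u (j,
    j)).
  by apply/funext => j /=; rewrite eqxx.
have /(asummable_reindex ei off) := us; rewrite E => es.
by rewrite (rsum_reindex ei off) E nneseries1_rsum.
Qed.

Lemma rate_idE s : ((rate (flux (fun j => j%:R)) s)%:E =
  - (2%:E * \sum_(1 <= j <oo) \sum_(j.+1 <= k <oo)
              (j%:R * W a (x s) j k)%:E)
  - \sum_(1 <= j <oo) (j%:R * W a (x s) j j)%:E)%E.
Proof.
have u_ge0 p : 0 <= p.1%:R * coag s p by rewrite mulr_ge0// coag_ge0.
have sub (P : pred (nat * nat)) : (forall p, P p -> (p.1 <= p.2)%N) ->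
    asummable (fun p => if P p then p.1%:R * coag s p else 0).
  move=> Pp; apply: asummable_le (minn_coag_summable s) => p.
  by case: ifP => [/Pp/minn_idPl ->//|_]; rewrite normr0.
rewrite rate_id EFinB EFinN EFinM; congr (- (_ * _) - _)%E.
- have := @nneseries2_rsum R 1 (fun j => j.+1) xpredT xpredT
    (fun j k => j%:R * coag s (j, k)).
  have -> : (fun p : nat * nat => if [&& (1 <= p.1)%N, true, (p.1.+1 <= p.2)%N
      & true]
             then p.1%:R * coag s (p.1, p.2) else 0) =
            (fun p => if (p.1 < p.2)%N then p.1%:R * coag s p else 0).
    apply/funext => -[[|j] k] /=; first by rewrite mul0r if_same.
    by rewrite andbT.
  move=> -> //; last by apply: sub => p /ltnW.
  by move=> p; case: ifP.
- rewrite -nneseries_diag//; last by rewrite mul0r.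
  by apply: sub => p /eqP ->.
Qed.

Lemma rate_posE s : ((rate (flux (fun j => (0 < j)%N%:R)) s)%:E =
  - ((1 / 2)%:E * \sum_(1 <= j <oo) \sum_(1 <= k <oo) (W a (x s) j k)%:E)
  - (1 / 2)%:E * \sum_(1 <= j <oo) (W a (x s) j j)%:E)%E.
Proof.
rewrite rate_pos EFinB EFinN !EFinM; congr (- (_ * _) - _ * _)%E.
- have := @nneseries2_rsum R 1 (fun=> 1%N) xpredT xpredT
    (fun j k => coag s (j, k)).
  have -> : (fun p : nat * nat => if [&& (1 <= p.1)%N, true, (1 <= p.2)%N &
      true]
             then coag s (p.1, p.2) else 0) = coag s.
    apply/funext => -[[|j] [|k]] //=; by rewrite coag_eq0.
  move=> -> //; first exact: coag_ge0.
  exact: (coag_summable xpredT).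
- rewrite -nneseries_diag//; [exact: coag_ge0|exact: coag_summable|].
  by rewrite coag_eq0.
Qed.

Lemma rate_oddE s : ((rate (flux (fun j => (odd j)%:R)) s)%:E =
  - \sum_(1 <= j <oo | odd j) \sum_(1 <= k <oo | odd k) (W a (x s) j k)%:E)%E.
Proof.
rewrite rate_odd EFinN; congr (- _)%E.
have := @nneseries2_rsum R 1 (fun=> 1%N) odd odd (fun j k => coag s (j, k)).
have -> : (fun p : nat * nat => if [&& (1 <= p.1)%N, odd p.1, (1 <= p.2)%N &
    odd p.2]
           then coag s (p.1, p.2) else 0) =
          (fun p => if odd p.1 && odd p.2 then coag s p else 0).
  by apply/funext => -[[|j] [|k]] //=; rewrite andbF.
move=> -> //; last exact: coag_summable.
by move=> p; case: ifP => // _; exact: coag_ge0.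
Qed.

(** On [S1] both [j] and [j - k] are at least [m]; on [S2] only [j] is, so the flux reduces to
    [- g j]. Outside both sets either [k = 0] and [coag] vanishes, or [j < m] and the flux
    vanishes. *)
Lemma rate_S1S2 C (g : nat -> R) (m : nat) s : 0 <= C -> (0 < m)%N ->
  lipschitz_weight C (fun j => if (m <= j)%N then g j else 0) ->
  (forall j, (0 < j)%N -> 0 <= g j) ->
  let f p := (g p.1 - g (p.1 - p.2)%N) * W a (x s) p.1 p.2 in
  summable (S1 m) (fun p => (f p)%:E) /\
  ((rate (flux (fun j => if (m <= j)%N then g j else 0)) s)%:E =
    - signed_esum (S1 m) f
    - \esum_(p in S2 m) (g p.1 * W a (x s) p.1 p.2)%:E)%E.
Proof.
move=> C0 m0 GC g_ge0 f.
pose G j := if (m <= j)%N then g j else 0.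
have Gs : asummable (fun p => flux G p * coag s p).
  exact: weighted_coag_summable (flux_dominated GC).
pose f1 p := if p \in S1 m then f p else 0.
pose f2 p := if p \in S2 m then g p.1 * W a (x s) p.1 p.2 else 0.
have S1E p : p \in S1 m -> f p = - (flux G p * coag s p).
  rewrite inE => -[mp /andP[p2 p2m]]; rewrite /f /flux /G (ltnW mp).
  have -> : (m <= p.1 - p.2)%N by lia.
  by rewrite -mulNr opprB.
have S2E p : p \in S2 m -> g p.1 * W a (x s) p.1 p.2 = - (flux G p * coag s p).
  rewrite inE => -[mp p2m]; rewrite /flux /G mp.
  have -> : (m <= p.1 - p.2)%N = false by lia.
  by rewrite sub0r mulNr opprK.
have f1s : asummable f1.
  apply: asummable_le Gs => p; rewrite /f1; case: ifP => [/S1E ->|_].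
    by rewrite normrN.
  by rewrite normr0.
have f2s : asummable f2.
  apply: asummable_le Gs => p; rewrite /f2; case: ifP => [/S2E ->|_].
    by rewrite normrN.
  by rewrite normr0.
have S1s : summable (S1 m) (EFin \o f).
  move: f1s; rewrite /asummable /summable [X in _ -> (X < _)%E]esum_mkcond.
  apply: le_lt_trans; apply: le_esum => p _ /=.
  by rewrite /f1; case: ifP.
split=> //; rewrite (signed_esum_rsum S1s) esum_rsum//; last first.
  move=> p [mp p2m]; have p10 : (0 < p.1)%N by exact: leq_trans mp.
  by rewrite mulr_ge0 ?g_ge0//; exact: (coag_ge0 s p).
rewrite -EFinN -EFinB; congr EFin; rewrite -rsumN// -rsumB//;
    last exact: asummableN.
apply: eq_rsum => p; change (flux G p * coag s p = - f1 p - f2 p).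
rewrite /f1 /f2; case: p => j k.
have [h1|h1] := boolP ((j, k) \in S1 m);
    have [h2|h2] := boolP ((j, k) \in S2 m).
- exfalso; move: h1 h2; rewrite !inE => -[/= h1 /andP[h3 h4]] [/= h5 h6]; lia.
- by rewrite S1E// opprK subr0.
- by rewrite S2E// opprK oppr0 add0r.
- rewrite oppr0 addr0; have [k0|k0] := posnP k.
    by rewrite coag_eq0 ?mulr0//= k0 orbT.
  rewrite /flux /G /=; case: ifP => mjk; case: ifP => mj.
  + exfalso; move: h1; rewrite notin_setE; apply; split => /=; lia.
  + exfalso; lia.
  + exfalso; move: h2; rewrite notin_setE; apply; split => /=; lia.
  + by rewrite subrr mul0r.
Qed.

(** * Integration in time and time regularity *)

Variable B : R.
Hypothesis mass_le : forall s, mass s <= B.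
Hypothesis mild : forall j t, (0 < j)%N -> 0 <= t ->
  ((x t j)%:E = (x 0 j)%:E + \int[lebesgue_measure]_(s in `[0%R, t])
     (\sum_(1 <= k <oo) (W a (x s) (j + k) k)%:E
      - \sum_(1 <= k <oo) (W a (x s) j k)%:E))%E.

Lemma rate_bound C phi s : 0 <= C -> dominated_weight C phi ->
  `|rate phi s| <= C * K * B ^+ 2.
Proof.
move=> C0 phiC; apply: (le_trans (rate_le s C0 phiC)).
have m0 : 0 <= mass s by apply: rsum_ge0 => j; rewrite mulr_ge0.
by rewrite ler_wpM2l ?mulr_ge0// lerXn2r// nnegrE// (le_trans m0).
Qed.

Lemma rate_integrable C phi (u v : R) : 0 <= C -> dominated_weight C phi ->
  measurable_fun [set: R] (rate phi) ->
  lebesgue_measure.-integrable `[u, v] (EFin \o rate phi).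
Proof.
move=> C0 phiC mphi; apply: measurable_bounded_integrable => //.
- by have := lebesgue_measure_itv `[u, v]; rewrite /= => ->; case: ifP;
    rewrite ?ltry.
- exact: measurable_funTS.
- exists (C * K * B ^+ 2); split; first exact: num_real.
  by move=> M /ltW ltM s _ /=; apply: le_trans ltM; exact: rate_bound.
Qed.

Lemma mild_real j t : (0 < j)%N -> 0 <= t ->
  x t j = x 0 j + \int[lebesgue_measure]_(s in `[0, t]) rate (gain_loss j) s.
Proof.
move=> j0 t0; apply/EFin_inj; rewrite mild// EFinD; congr (_ + _)%E.
rewrite /Rintegral fineK.
  by apply: eq_integral => s _; case: (gain_lossE s j0).
apply: integrable_fin_num => //; apply: rate_integrable ler01 _ _.
- exact: gain_loss_dominated.
- exact: gain_loss_measurable.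
Qed.

(** Decomposes a weight supported in [1..n] into indicators of singletons; the shift [j.+1] leaves
    out the index 0, which carries no mild equation. *)
Lemma sum_deltaE (G : nat -> R) n i : G 0%N = 0 ->
  (forall j, (n < j)%N -> G j = 0) ->
  \sum_(0 <= j < n) G j.+1 * (i == j.+1)%:R = G i.
Proof.
move=> G0 Gn; case: i => [|i].
  by rewrite G0 big1// => j _; rewrite mulr0.
have [ni|ni] := ltnP i n; last first.
  rewrite Gn// big_nat big1// => j /andP[_ jn].
  by rewrite eqSS gtn_eqF ?mulr0// (leq_trans jn).
rewrite (bigD1_seq i) ?iota_uniq ?mem_index_iota//= eqxx mulr1.
by rewrite big1 ?addr0// => j /negbTE ji; rewrite eqSS eq_sym ji mulr0.
Qed.

Lemma weak_form_finite C (G : nat -> R) n t : 0 <= C -> lipschitz_weight C G ->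
  (forall j, (n < j)%N -> G j = 0) -> 0 <= t ->
  measurable_fun [set: R] (rate (flux G)) /\
  rsum (fun j => G j * x t j) = rsum (fun j => G j * x 0 j) +
    \int[lebesgue_measure]_(s in `[0, t]) rate (flux G) s.
Proof.
move=> C0 GC Gn t0; have [G0 _] := GC.
pose c j s := rate (gain_loss j.+1) s.
(* [flux] is linear in the weight, so the decomposition of [G] into indicators carries over to the
   rates. *)
have fluxE : rate (flux G) = (fun s => \sum_(0 <= j < n) G j.+1 * c j s).
  apply/funext => s; rewrite /rate.
  have -> : (fun p => flux G p * coag s p) = (fun p =>
      \sum_(0 <= j < n) G j.+1 * (gain_loss j.+1 p * coag s p)).
    apply/funext => p; rewrite /gain_loss /flux -!(sum_deltaE _ G0 Gn).
    rewrite -sumrB mulr_suml; apply: eq_bigr => j _.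
    by rewrite -mulrBr mulrA.
  have gs j : asummable (fun p => gain_loss j.+1 p * coag s p).
    by apply: (weighted_coag_summable s ler01); exact: gain_loss_dominated.
  rewrite rsum_sum => [|j]; last exact: asummableZ.
  by apply: eq_bigr => j _; rewrite rsumZ.
have cm j : measurable_fun [set: R] (c j) by exact: gain_loss_measurable.
have ci j : lebesgue_measure.-integrable `[0, t] (EFin \o c j).
  exact: rate_integrable ler01 (gain_loss_dominated _) (cm _).
have cGi j : lebesgue_measure.-integrable `[0, t]
    (EFin \o (fun s => G j.+1 * c j s)).
  by apply: eq_integrable (integrableZl _ (G j.+1) (ci j)) => // s _ /=.
have sumE s : rsum (fun j => G j * x s j) = \sum_(0 <= j < n) G j.+1 * x s j.+1.
  have -> : (fun j => G j * x s j) = (fun i =>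
      \sum_(0 <= j < n) G j.+1 * ((i == j.+1)%:R * x s i)).
    apply/funext => i; rewrite -{1}(sum_deltaE i G0 Gn) mulr_suml.
    by apply: eq_bigr => j _; rewrite mulrA.
  have gs j : asummable (fun i => (i == j.+1)%:R * x s i).
    apply: (asummable_dom _ (x_summable s)) => -[|i];
        first by rewrite x0 !mulr0 normr0.
    rewrite normrM normr_nat (ger0_norm (x_ge0 _ _)) ler_wpM2r// ler_nat.
    by case: (_ == _).
  rewrite rsum_sum => [|j]; last exact: asummableZ.
  apply: eq_bigr => j _; rewrite rsumZ// (@rsum_single _ _ j.+1) ?eqxx ?mul1r//.
  by move=> i /negbTE ->; rewrite mul0r.
split.
  rewrite fluxE; apply: measurable_sum => j.
  by apply: measurable_funM => //; exact: measurable_cst.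
rewrite !sumE fluxE.
have -> : \int[lebesgue_measure]_(s in `[0, t]) (\sum_(0 <= j < n) G j.+1 * c j
    s) =
    \sum_(0 <= j < n) G j.+1 * \int[lebesgue_measure]_(s in `[0, t]) c j s.
  elim: (index_iota 0 n) => [|j l IHl].
    under eq_Rintegral do rewrite big_nil.
    by rewrite Rintegral_cst// mul0r big_nil.
  under eq_Rintegral do rewrite big_cons.
  rewrite RintegralD//.
  - by rewrite IHl big_cons RintegralZl.
  - rewrite (_ : EFin \o _ = (fun s => \sum_(i <- l) (G i.+1 * c i s)%:E)%E).
      by apply: integrable_sum => // i _; exact: cGi.
    by apply/funext => s /=; rewrite sumEFin.
rewrite -big_split /=; apply: eq_bigr => j _.
by rewrite -mulrDr; congr (_ * _); exact: mild_real.
Qed.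

Lemma weak_form C (G : nat -> R) t : 0 <= C -> lipschitz_weight C G ->
  (forall j, 0 <= G j) -> 0 <= t ->
  measurable_fun [set: R] (rate (flux G)) /\
  rsum (fun j => G j * x t j) = rsum (fun j => G j * x 0 j) +
    \int[lebesgue_measure]_(s in `[0, t]) rate (flux G) s.
Proof.
move=> C0 GC G_ge0 t0; have [G0 GL] := GC.
pose Gn n j := Num.min (G j) (C * (n - j)%:R).
have Gn_lip n : lipschitz_weight C (Gn n).
  split; first by rewrite /Gn G0 min_l// mulr_ge0.
  move=> i k.
  have := GL i k; rewrite /Gn.
  (* Truncated subtraction from [n] is 1-Lipschitz, so both arguments of the minimum are
     [C]-Lipschitz. *)
  have : `|C * (n - (i + k))%:R - C * (n - i)%:R| <= C * k%:R.
    rewrite -mulrBr normrM (ger0_norm C0) ler_wpM2l// distrC.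
    rewrite -natrB ?leq_sub2l ?leq_addr// normr_nat ler_nat; lia.
  (* After generalization it remains that the minimum of two functions with increments at most [e]
     has increments at most [e], which is linear in each case. *)
  move: (C * k%:R) (C * _) (C * _) (G _) (G _) => e u v y z.
  by rewrite /Num.min !ler_norml => /andP[? ?] /andP[? ?];
    do 2 case: ltP => ?; apply/andP; split; lra.
have Gn_fin n j : (n < j)%N -> Gn n j = 0.
  by move=> nj; rewrite /Gn (eqP (ltnW nj : (n - j == 0)%N)) mulr0 min_r.
have G_le j : `|G j| <= C * j%:R.
  by have := GL 0%N j; rewrite add0n G0 subr0.
have Gn_le n j : `|Gn n j| <= C * j%:R.
  by have [Gn0 /(_ 0%N j)] := Gn_lip n; rewrite add0n Gn0 subr0.
have Gn_cvg j : Gn n j @[n --> \oo] --> G j.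
  apply: cvg_near_cst; near=> n; rewrite /Gn min_l//.
  apply: (le_trans (ler_norm _)); apply: (le_trans (G_le j)).
  rewrite ler_wpM2l// ler_nat.
  (* For [n >= 2 j] one has [G j <= C j <= C (n - j)], so the cut-off is inactive at [j]. *)
  have : (j + j <= n)%N by near: n; exact: nbhs_infty_ge.
  lia.
have rate_cvg s : rate (flux (Gn n)) s @[n --> \oo] --> rate (flux G) s.
  apply: (rsum_cvg_dom (asummable_bound C s)) => [n p|p|p].
  - exact: weighted_coag_le (flux_dominated (Gn_lip n)).
  - exact: weighted_coag_le (flux_dominated GC).
  - by apply: cvgM; [apply: cvgB; exact: Gn_cvg|exact: cvg_cst].
have F_cvg s : rsum (fun j => Gn n j * x s j) @[n --> \oo] -->
    rsum (fun j => G j * x s j).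
  apply: (rsum_cvg_dom (asummableZ C (x_summable s))) => [n j|j|j].
  - by rewrite normrM mulrA (ger0_norm (x_ge0 _ _)) ler_wpM2r.
  - by rewrite normrM mulrA (ger0_norm (x_ge0 _ _)) ler_wpM2r.
  - by apply: cvgM; [exact: Gn_cvg|exact: cvg_cst].
have wf n := weak_form_finite C0 (Gn_lip n) (@Gn_fin n) t0.
have rm : measurable_fun [set: R] (rate (flux G)).
  apply: (@measurable_fun_cvg _ _ _ _ (fun n => rate (flux (Gn n)))) => [n|s _].
    by have [] := wf n.
  exact: rate_cvg.
have ri (phi : nat * nat -> R) : dominated_weight C phi -> measurable_fun [set:
    R] (rate phi) ->
    (\int[lebesgue_measure]_(s in `[0%R, t]) (rate phi s)%:E)%E \is a fin_num.
  by move=> phiC mphi; apply: integrable_fin_num => //;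
      exact: rate_integrable C0 phiC mphi.
have I_cvg : \int[lebesgue_measure]_(s in `[0, t]) rate (flux (Gn n)) s @[n -->
    \oo] -->
    \int[lebesgue_measure]_(s in `[0, t]) rate (flux G) s.
  suff : (\int[lebesgue_measure]_(s in `[0%R, t]) (rate (flux (Gn n)) s)%:E)%E
      @[n --> \oo] -->
      (\int[lebesgue_measure]_(s in `[0%R, t]) (rate (flux G) s)%:E)%E.
    by rewrite -[X in _ --> X]fineK ?ri//;
        [exact: fine_cvg|exact: flux_dominated].
  (* All cut-offs share the constant [C], so one constant bounds all their rates, and it is
     integrable on the bounded interval. *)
  have DC := @dominated_cvg _ _ R lebesgue_measure `[0, t] (measurable_itv _)
    (fun n s => (rate (flux (Gn n)) s)%:E) (fun s => (rate (flux G) s)%:E) (cst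
        (C * K * B ^+ 2)%:E).
  apply: DC => //.
  - by move=> n; apply/measurable_EFinP/measurable_funTS; have [] := wf n.
  - by move=> s _; apply: cvg_EFin; [exact: nearW|exact: rate_cvg].
  - apply: measurable_bounded_integrable => //.
      by have := lebesgue_measure_itv `[0, t]; rewrite /= => ->; case: ifP;
          rewrite ?ltry.
    exists (C * K * B ^+ 2); split; first exact: num_real.
    move=> M /ltW ltM s _ /=; apply: le_trans ltM; rewrite ger0_norm//.
    by rewrite (mulr_ge0 (mulr_ge0 C0 K_ge0))// sqr_ge0.
  - move=> n s _; rewrite lee_fin; apply: rate_bound => //.
    exact: flux_dominated.
have RHS_cvg : rsum (fun j => Gn n j * x t j) @[n --> \oo] -->
    rsum (fun j => G j * x 0 j) +
    \int[lebesgue_measure]_(s in `[0, t]) rate (flux G) s.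
  under eq_cvg do rewrite (wf _).2.
  by apply: cvgD; [exact: F_cvg|exact: I_cvg].
split=> //; apply: (cvg_unique _ (F_cvg t) RHS_cvg).
Unshelve. all: by end_near. Qed.

Hypothesis x_neg : forall s, s <= 0 -> x s = x 0.

(** The weak form with [G j = j] has a rate bounded by [K * B ^+ 2]. Measurability and boundedness
    of the rate suffice here, so there is no circularity in deducing continuity of the rates from
    that of [mass]. *)
Lemma lipschitz_mass s t : s <= t -> `|mass t - mass s| <= K * B ^+ 2 * (t - s).
Proof.
have L0 : 0 <= K * B ^+ 2 by rewrite mulr_ge0// sqr_ge0.
have lipid : lipschitz_weight 1 (fun j : nat => j%:R : R).
  by split=> // i k; rewrite natrD addrAC subrr add0r mul1r normr_nat.
have pos u v : 0 <= u -> u <= v -> `|mass v - mass u| <= K * B ^+ 2 * (v - u).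
  move=> u0 uv; have v0 := le_trans u0 uv.
  have wf w := @weak_form 1 (fun j => j%:R) w ler01 lipid (fun j => ler0n _ j).
  have [mD] := wf u u0; rewrite -!/(mass _) => ->.
  have [_] := wf v v0; rewrite -!/(mass _) => ->.
  have Dint p q := rate_integrable p q ler01 (flux_dominated lipid) mD.
  rewrite opprD addrACA subrr add0r.
  rewrite Rintegral_itvB//.
  have sub : `]u, v] `<=` `[0, v].
    by move=> w /=; rewrite !in_itv /= => /andP[uw ->];
        rewrite (le_trans u0)// ltW.
  have Dint' : lebesgue_measure.-integrable `]u, v] (EFin \o rate (flux (fun j
      => j%:R))).
    by apply: integrableS (Dint 0 v).
  apply: (le_trans (le_normr_Rintegral _ Dint')) => //.
  have muE := lebesgue_measure_itv `]u, v]; rewrite /= lte_fin in muE.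
  rewrite (_ : K * B ^+ 2 * (v - u) = \int[lebesgue_measure]_(w in `]u, v]) (K
      * B ^+ 2)); last first.
    rewrite Rintegral_cst//= muE; case: ltgtP uv => //= -> _.
    by rewrite subrr.
  apply: le_Rintegral => //.
  - exact: integrable_norm.
  - apply: measurable_bounded_integrable => //; first by rewrite /= muE;
      case: ifP; rewrite ?ltry.
    exists (K * B ^+ 2); split; first exact: num_real.
    by move=> M /ltW ltM w _ /=; rewrite ger0_norm.
  - move=> w _; have := rate_bound w ler01 (flux_dominated lipid).
    by rewrite mul1r.
(* Negative times reduce to 0, and [r] to [max r 0] does not increase distances. *)
have massE r : mass r = mass (Num.max r 0).
  by have [r0|//] := leP r 0; rewrite /mass x_neg.
move=> st; rewrite massE [mass s]massE.
apply: (@le_trans _ _ (K * B ^+ 2 * (Num.max t 0 - Num.max s 0))).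
  apply: pos; first by rewrite le_max lexx orbT.
  by rewrite ge_max !le_max st lexx !orbT.
by rewrite ler_wpM2l//; move: st; rewrite /Num.max; do 2 case: ltP => ?; lra.
Qed.

Lemma mass_continuous : continuous mass.
Proof.
move=> s; apply/cvgrPdist_le => e e0.
have L0 : 0 <= K * B ^+ 2 by rewrite mulr_ge0// sqr_ge0.
near=> t.
(* The added 1 keeps the denominator positive when [K * B ^+ 2 = 0]. *)
have tl : `|s - t| <= e / (K * B ^+ 2 + 1).
  near: t; apply: cvgr_dist_le; first exact: cvg_id.
  by rewrite divr_gt0// ltr_wpDl.
apply: (@le_trans _ _ (K * B ^+ 2 * `|s - t|)).
  have [ts|/ltW ts] := leP t s.
    by rewrite (@ger0_norm _ (s - t)) ?subr_ge0// lipschitz_mass.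
  rewrite distrC (distrC s) (@ger0_norm _ (t - s)) ?subr_ge0//.
  exact: lipschitz_mass.
apply: (@le_trans _ _ ((K * B ^+ 2 + 1) * (e / (K * B ^+ 2 + 1)))).
  by rewrite ler_pM// lerDl.
by rewrite mulrC divfK// gt_eqF// ltr_wpDl.
Unshelve. all: by end_near. Qed.

Theorem moment_derivative C (G : nat -> R) : 0 <= C -> lipschitz_weight C G ->
  (forall j, 0 <= G j) ->
  continuous (rate (flux G)) /\
  forall t, 0 <= t -> has_derivative_within `[0, +oo[
    (fun s => rsum (fun j => G j * x s j)) t (rate (flux G) t).
Proof.
move=> C0 GC G_ge0.
have Dc : continuous (rate (flux G)).
  exact: rate_continuous C0 (flux_dominated GC) mass_continuous.
have Dint p q := rate_integrable p q C0 (flux_dominated GC)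
    (continuous_measurable_fun Dc).
split=> // t t0.
(* Starting at [-1] makes [t = 0] an interior point, so the fundamental theorem of calculus applies
   there as well; the rate is continuous on the whole line. *)
pose Phi u := \int[lebesgue_measure]_(s in `[-1, u]) rate (flux G) s.
have t1 : -1 < t by rewrite (lt_le_trans _ t0)// ltrN10.
have tu : t < t + 1 by rewrite ltrDl.
have [dPhi PhiE] := continuous_FTC1_closed tu (Dint (-1) (t + 1)) t1 (Dc t).
apply: (has_derivative_within_primitive (Phi := Phi)
  (r := rsum (fun j => G j * x 0 j) - Phi 0)) dPhi PhiE.
  by rewrite /= in_itv /= t0.
move=> s /=; rewrite in_itv /= andbT => s0.
have [_ ->] := weak_form C0 GC G_ge0 s0.
(* [Phi s - Phi 0] is the integral over the half-open interval from 0 to [s], which equals the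
   integral over the closed one. *)
rewrite -addrA; congr (_ + _); rewrite addrC.
rewrite /Phi Rintegral_itvB ?bnd_simp ?lerN10//.
rewrite Rintegral_itv_obnd_cbnd//.
apply: integrableS (Dint 0 s) => //.
exact: subset_itv_oc_cc.
Qed.

End weak_form.

(** * The given solution *)

(** As [j * k >= 1], the power increases with its exponent, negative exponents included, so the
    square root is the worst case, and [j * k] is at most the square of the maximum. *)
Lemma powR_prod_le_maxn (R : realType) (beta : R) j k : beta <= 1 / 2 ->
  (0 < j)%N -> (0 < k)%N -> (j%:R * k%:R) `^ beta <= (maxn j k)%:R.
Proof.
move=> hb j0 k0; have jk1 : 1 <= j%:R * k%:R :> R.
  by rewrite -natrM ler1n muln_gt0 j0.
apply: (@le_trans _ _ ((j%:R * k%:R) `^ (1 / 2))); first exact: ler_powR.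
rewrite div1r powR12_sqrt ?(le_trans ler01)// -(ler_sqr (sqrtr_ge0 _))
    ?nnegrE//.
rewrite sqr_sqrtr ?(le_trans ler01)// expr2.
by rewrite ler_pM// ler_nat ?leq_maxl ?leq_maxr.
Qed.

Section extension.
Context {R : realType}.
Variables (a : nat -> nat -> R) (c0 : nat -> R) (c : R -> nat -> R).
Hypothesis hc : rbk_solution a +oo%E c0 c.

(* Constant continuation to negative times makes every coordinate continuous on
   the whole line; the junk coordinate 0 is set to 0. *)
Definition extend (s : R) (j : nat) : R :=
  if (0 < j)%N then c (Num.max s 0) j else 0.

Lemma time_domainy (s : R) : time_domain +oo%E s <-> 0 <= s.
Proof. by rewrite /time_domain /= ltry; split=> [[]|]. Qed.

Lemma extendE s j : 0 <= s -> (0 < j)%N -> extend s j = c s j.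
Proof. by move=> s0 j0; rewrite /extend j0 max_l. Qed.

Lemma max0_domain (s : R) : time_domain +oo%E (Num.max s 0 : R).
Proof. by apply/time_domainy; rewrite le_max lexx orbT. Qed.

Lemma extend_ge0 s j : 0 <= extend s j.
Proof.
rewrite /extend; case: ifP => // j0.
by have [_ /(_ j j0)] := rbk_values hc (max0_domain s).
Qed.

Lemma extend0 s : extend s 0%N = 0.
Proof. by []. Qed.

Lemma extend_neg s : s <= 0 -> extend s = extend 0.
Proof. by move=> s0; apply/funext => j; rewrite /extend max_r// maxxx. Qed.

Lemma norm1_extend (s : R) : (norm1 (c (Num.max s 0%R)) =
  \esum_(j in [set: nat]) (j%:R * extend s j)%:E)%E.
Proof.
rewrite /norm1 nneseries_esum_from => [|j _ _];
    last by rewrite lee_fin mulr_ge0.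
rewrite esum_mkcond; apply: eq_esum => j _; rewrite /extend.
case: ifPn.
  rewrite inE /= andbT => j0; rewrite j0 ger0_norm//.
  by have [_ /(_ j j0)] := rbk_values hc (max0_domain s).
by rewrite notin_setE /= andbT => /negP/negbTE ->; rewrite mulr0.
Qed.

Lemma extend_summable s : asummable (fun j => j%:R * extend s j).
Proof.
have [+ _] := rbk_values hc (max0_domain s).
rewrite /X1 /= norm1_extend; apply: le_lt_trans; apply: le_esum => j _ /=.
by rewrite ger0_norm// mulr_ge0// extend_ge0.
Qed.

Lemma mass_extend_le : exists B : R, forall s, mass extend s <= B.
Proof.
set S := ereal_sup [set norm1 (c t) | t in time_domain +oo%E].
have Sy : (S < +oo)%E by exact: rbk_bounded hc.
have le s : ((mass extend s)%:E <= S)%E.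
  rewrite /mass rsum_ge0E ?extend_summable//; last first.
    by move=> j; rewrite mulr_ge0// extend_ge0.
  rewrite -norm1_extend; apply: ereal_sup_ubound.
  by exists (Num.max s 0) => //; exact: max0_domain.
(* Besides being less than [+oo], the supremum dominates a real number and so is not [-oo]. *)
have Sfin : S \is a fin_num.
  rewrite fin_numE (lt_eqF Sy) andbT; apply/eqP => SE.
  by have := le 0; rewrite SE leeNy_eq.
by exists (fine S) => s; rewrite -lee_fin (fineK Sfin).
Qed.

(** Continuity relative to the time domain composes with the continuous map [max s 0], whose values
    lie in that domain. *)
Lemma extend_continuous j : continuous (fun s => extend s j).
Proof.
case: j => [|j] s; first exact: cvg_cst.
have /subspace_continuousP cc := @rbk_continuous _ _ _ _ _ hc j.+1 (ltn0Sn j).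
have {}cc := cc _ (max0_domain s).
apply: cvg_comp cc => P; rewrite /within /= => nP.
have mc : Num.max t 0 @[t --> s] --> Num.max s 0.
  by apply: continuous_max; [exact: cvg_id|exact: cvg_cst].
have := mc _ nP; apply: (@filterS _ (nbhs s)) => t /=; apply.
exact: max0_domain.
Qed.

Lemma extend_mild j t : (0 < j)%N -> 0 <= t ->
  ((extend t j)%:E = (extend 0 j)%:E + \int[lebesgue_measure]_(s in `[0%R, t])
     (\sum_(1 <= k <oo) (W a (extend s) (j + k) k)%:E
      - \sum_(1 <= k <oo) (W a (extend s) j k)%:E))%E.
Proof.
move=> j0 t0; rewrite !extendE//.
(* The mild equation at time 0, where the integral is over a single point, gives the initial
   condition. *)
have -> : c 0 j = c0 j.
  apply/EFin_inj; rewrite (rbk_mild hc j0); last exact/time_domainy.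
  by rewrite set_itv1 integral_set1 adde0.
rewrite (rbk_mild hc j0); last exact/time_domainy.
congr (_ + _)%E; apply: eq_integral => s;
    rewrite inE /= in_itv /= => /andP[s0 _].
by congr (_ - _)%E; apply: congr_lim; apply/funext => n;
  apply: eq_big_nat => k /andP[k0 _]; rewrite /W !extendE// addn_gt0 j0.
Qed.

End extension.

Lemma has_derivative_within_eq (R : realType) (A : set R) (F F' : R -> R) (t d
    : R) :
  A t -> (forall s, A s -> F s = F' s) ->
  has_derivative_within A F' t d -> has_derivative_within A F t d.
Proof.
move=> At FF'; rewrite /has_derivative_within; apply: cvg_trans.
apply: near_eq_cvg; near=> s; have As : A s by near: s; exact: withinT.
by rewrite !FF'.
Unshelve. all: by end_near. Qed.

Lemma eq_lim_series (R : realType) (m : nat) (P : pred nat) (u v : nat -> R) :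
  (forall j, (m <= j)%N -> P j -> u j = v j) ->
  \big[+%R/0]_(m <= j <oo | P j) u j = \big[+%R/0]_(m <= j <oo | P j) v j.
Proof.
move=> uv; congr (lim (_ @ \oo)); apply/funext => n.
rewrite big_nat_cond [RHS]big_nat_cond.
by apply: eq_bigr => j /andP[/andP[mj _] Pj]; exact: uv.
Qed.

Lemma eq_nneseries_from (R : realType) (m : nat) (P : pred nat) (u v : nat ->
    \bar R) :
  (forall j, (m <= j)%N -> P j -> u j = v j) ->
  (\sum_(m <= j <oo | P j) u j = \sum_(m <= j <oo | P j) v j)%E.
Proof.
move=> uv; apply: congr_lim; apply/funext => n.
rewrite big_nat_cond [RHS]big_nat_cond.
by apply: eq_bigr => j /andP[/andP[mj _] Pj]; exact: uv.
Qed.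

Theorem proposition6p2 (R : realType) (a : nat -> nat -> R) (K beta : R)
    (c0 : nat -> R) (c : R -> nat -> R)
    (ha : rate_coefficients a)
    (hK : 0 < K) (hbeta : beta <= 1 / 2)
    (haK : forall j k : nat, (1 <= j)%N -> (1 <= k)%N ->
       a j k <= K * (j%:R * k%:R) `^ beta)
    (hc : rbk_solution a +oo%E c0 c) :
  (forall (g : nat -> R) (M : R),
     (forall j : nat, (1 <= j)%N -> 0 <= g j <= j%:R) ->
     0 < M ->
     (forall j k : nat, (1 <= k < j)%N -> `|g j - g (j - k)%N| <= M * k%:R) ->
     forall m : nat, (1 <= m)%N ->
     exists D : R -> R,
       {within `[0, +oo[, continuous D} /\
       forall t : R, 0 <= t ->
         has_derivative_within `[0, +oo[
           (fun s => \big[+%R/0]_(m <= j <oo) (g j * c s j)) t (D t) /\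
         summable (S1 m) (fun p =>
           ((g p.1 - g (p.1 - p.2)%N) * W a (c t) p.1 p.2)%:E) /\
         ((D t)%:E =
           - signed_esum (S1 m) (fun p =>
               ((g p.1 - g (p.1 - p.2)%N) * W a (c t) p.1 p.2)%R)
           - \esum_(p in S2 m) (g p.1 * W a (c t) p.1 p.2)%:E)%E) /\
  (forall t : R, 0 <= t -> exists d : R,
     has_derivative_within `[0, +oo[
       (fun s => \big[+%R/0]_(1 <= j <oo) (j%:R * c s j)) t d /\
     (d%:E =
       - (2%:E * \sum_(1 <= j <oo) \sum_(j.+1 <= k <oo)
                   (j%:R * W a (c t) j k)%:E)
       - \sum_(1 <= j <oo) (j%:R * W a (c t) j j)%:E)%E) /\
  (forall t : R, 0 <= t -> exists d : R,
     has_derivative_within `[0, +oo[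
       (fun s => \big[+%R/0]_(1 <= j <oo) c s j) t d /\
     (d%:E =
       - ((1 / 2)%:E * \sum_(1 <= j <oo) \sum_(1 <= k <oo)
                         (W a (c t) j k)%:E)
       - (1 / 2)%:E * \sum_(1 <= j <oo) (W a (c t) j j)%:E)%E) /\
  (forall t : R, 0 <= t -> exists d : R,
     has_derivative_within `[0, +oo[
       (fun s => \big[+%R/0]_(1 <= j <oo | odd j) c s j) t d /\
     (d%:E =
       - \sum_(1 <= j <oo | odd j) \sum_(1 <= k <oo | odd k)
           (W a (c t) j k)%:E)%E).
Proof.
have a_sym j k : (0 < j)%N -> (0 < k)%N -> a j k = a k j.
  by move=> j0 k0; case: (ha j k j0 k0).
have a_ge0 j k : (0 < j)%N -> (0 < k)%N -> 0 <= a j k.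
  by move=> j0 k0; case: (ha j k j0 k0).
have a_le j k : (0 < j)%N -> (0 < k)%N -> a j k <= K * (maxn j k)%:R.
  move=> j0 k0; apply: (le_trans (haK _ _ j0 k0)).
  by rewrite ler_wpM2l ?(ltW hK)// powR_prod_le_maxn.
have [B mass_le] := mass_extend_le hc.
(* Carries [moment_derivative] from the extension and [rsum] back to [c] and the ordered series: [G]
   must match the summand on the range of summation and vanish off it. *)
have deriv C G : 0 <= C -> lipschitz_weight C G -> (forall j, 0 <= G j) ->
    continuous (rate a (extend c) (flux G)) /\
    forall m (P : pred nat) (u : R -> nat -> R), (0 < m)%N ->
    (forall s j, 0 <= s -> (m <= j)%N -> P j -> u s j = G j * c s j) ->
    (forall j, ~~ ((m <= j)%N && P j) -> G j = 0) ->
    forall t, 0 <= t -> has_derivative_within `[0, +oo[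
      (fun s => \big[+%R/0]_(m <= j <oo | P j) u s j) t
      (rate a (extend c) (flux G) t).
  move=> C0 GC G_ge0.
  have [rc der] := moment_derivative (ltW hK) a_ge0 a_le (extend_ge0 hc)
    (@extend0 _ c) (extend_summable hc) (extend_continuous hc) mass_le
    (extend_mild hc) (@extend_neg _ c) C0 GC G_ge0.
  split=> // m P u m0 uE G0 t t0.
  apply: has_derivative_within_eq (der t t0).
    by rewrite /= in_itv /= t0.
  move=> s /=; rewrite in_itv /= andbT => s0.
  rewrite (@eq_lim_series _ _ _ _ (fun j => G j * extend c s j)).
    rewrite lim_series_rsum.
      apply: eq_rsum => j; case: ifPn => // /G0 ->.
      by rewrite mul0r.
    have [GZ GL] := GC.
    apply: (asummable_dom _ (asummableZ C (extend_summable hc s))) => j.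
    rewrite normrM mulrA (ger0_norm (extend_ge0 hc _ _)) ler_wpM2r ?(extend_ge0
        hc)//.
    by have := GL 0%N j; rewrite add0n GZ subr0.
  move=> j mj Pj; rewrite uE// extendE//.
  exact: leq_trans mj.
have WE t j k : 0 <= t -> (0 < j)%N -> (0 < k)%N ->
    W a (c t) j k = W a (extend c t) j k.
  by move=> t0 j0 k0; rewrite /W !extendE.
split.
  move=> g M g_bd M0 gL m m0.
  pose G j := if (m <= j)%N then g j else 0.
  have g_ge0 j : (0 < j)%N -> 0 <= g j by move=> /g_bd /andP[].
  have g_le j : (0 < j)%N -> g j <= j%:R by move=> /g_bd /andP[].
  have m1 : 1 <= m%:R :> R by rewrite ler1n.
  have C0 : 0 <= M + m%:R by rewrite addr_ge0// ltW.
  (* [M] controls increments from indices at least [m], and [m] controls the jump created by the cut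
     at [m]. *)
  have GC : lipschitz_weight (M + m%:R) G.
    split; first by rewrite /G leqNgt m0.
    move=> i k; rewrite /G; case: (leqP m i) => mi.
      rewrite (leq_trans mi (leq_addr _ _)).
      have [->|k0] := posnP k; first by rewrite addn0 subrr normr0 mulr0.
      have kik : (1 <= k < i + k)%N by lia.
      have := gL _ _ kik; rewrite addnK => /le_trans; apply.
      by rewrite ler_wpM2r// lerDl.
    case: ifP => mik; last by rewrite subrr normr0 mulr_ge0.
    have ik0 : (0 < i + k)%N by exact: leq_trans mik.
    rewrite subr0 ger0_norm ?g_ge0//; apply: (le_trans (g_le _ ik0)).
    apply: (@le_trans _ _ (m%:R * k%:R)); last first.
      by rewrite ler_wpM2r// lerDr ltW.
    (* From [i < m <= i + k] follow [k >= 1] and [i + k <= (m - 1) + k <= m * k]. *)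
    rewrite -natrM ler_nat; nia.
  have G_ge0 j : 0 <= G j by rewrite /G; case: ifP => // mj;
      rewrite g_ge0// (leq_trans m0).
  have [Dc der] := deriv _ _ C0 GC G_ge0.
  exists (rate a (extend c) (flux G)); split; first exact: continuous_subspaceT.
  move=> t t0; split.
    apply: (der m xpredT (fun s j => g j * c s j)) => //.
      by move=> s j s0 mj _; rewrite /G mj.
    by move=> j; rewrite andbT /G => /negbTE ->.
  have [sS1 rE] := rate_S1S2 (ltW hK) a_ge0 a_le (extend_ge0 hc)
    (@extend0 _ c) (extend_summable hc) t C0 m0 GC g_ge0.
  have WS1 p : S1 m p -> W a (c t) p.1 p.2 = W a (extend c t) p.1 p.2.
    by move=> [mp /andP[p2 _]]; rewrite WE// (leq_ltn_trans _ mp).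
  split.
    move: sS1; rewrite /summable; apply: le_lt_trans;
        apply: le_esum => p /WS1 pE.
    by rewrite pE.
  rewrite rE /signed_esum; congr (- (_ - _) - _)%E; apply: eq_esum => p.
  - by move=> /WS1 pE; rewrite !funeposE /= pE.
  - by move=> /WS1 pE; rewrite !funenegE /= pE.
  - by move=> [mp p2]; rewrite WE// (leq_trans _ mp, leq_trans _ p2).
split=> [t t0|].
  have [_ der] := deriv _ _ ler01 id_lipschitz (fun j => ler0n _ j).
  exists (rate a (extend c) (flux (fun j => j%:R)) t); split.
    apply: (der 1%N xpredT (fun s j => j%:R * c s j)) => //.
    by case.
  rewrite (rate_idE (ltW hK) a_sym a_ge0 a_le (extend_ge0 hc) (@extend0 _ c)
    (extend_summable hc)).
  congr (- (_ * _) - _)%E; apply: eq_nneseries_from => j j0 _;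
      last by rewrite WE.
  apply: eq_nneseries_from => k jk _; rewrite WE//.
  exact: leq_trans jk.
split=> t t0.
  have [_ der] := deriv _ _ ler01 (@indicator_lipschitz R [pred j | 0 < j]%N
      isT) (fun j => ler0n _ _).
  exists (rate a (extend c) (flux (fun j => (0 < j)%N%:R)) t); split.
    apply: (der 1%N xpredT (fun s j => c s j)) => //.
      by move=> s j _ j0 _; rewrite /= j0 mul1r.
    by case.
  rewrite (rate_posE (ltW hK) a_sym a_ge0 a_le (extend_ge0 hc) (@extend0 _ c)
    (extend_summable hc)).
  congr (- (_ * _) - _ * _)%E; apply: eq_nneseries_from => j j0 _;
      last by rewrite WE.
  by apply: eq_nneseries_from => k k0 _; rewrite WE.
have [_ der] := deriv _ _ ler01 (@indicator_lipschitz R odd isT) (fun j =>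
    ler0n _ _).
exists (rate a (extend c) (flux (fun j => (odd j)%:R)) t); split.
  apply: (der 1%N odd (fun s j => c s j)) => //.
    by move=> s j _ _ jo; rewrite /= jo mul1r.
  by case=> [|j] //= /negbTE ->.
rewrite (rate_oddE (ltW hK) a_sym a_ge0 a_le (extend_ge0 hc) (@extend0 _ c)
  (extend_summable hc)).
congr (- _)%E; apply: eq_nneseries_from => j j0 _.
by apply: eq_nneseries_from => k k0 _; rewrite WE.
Qed.
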